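(* Let $n\ge 1$ be an integer, let $\mathcal R\subset\mathbb R^n\setminus\{0\}$ be a root system with finite reflection group $G$, let $k\ge 0$ be a non-negative multiplicity function on $\mathcal R$, and let $\gamma=\frac12\sum_{\alpha\in\mathcal R}k_\alpha$. Suppose $p,q\ge 1$ and $r$ satisfy $$2\gamma<\frac{n(p+1)}{p-1}\qquad\text{and}\qquad r>\frac{2pn}{(p+1)n-(p-1)2\gamma}.$$ Then there exist an orthonormal system $(f_j)_j$ in $L^2_k(\mathbb R^n)$ and a sequence $\lambda=(\lambda_j)_j\in\ell^r(\mathbb C)$ such that $$\left\|\sum_j\lambda_j\left|e^{-it\mathcal H_k}f_j\right|^2\right\|_{L^q\left((-\frac{\pi}{2},\frac{\pi}{2}),\,L^p_k(\mathbb R^n)\right)}=\infty .$$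
   Context: Dunkl setting. For $\alpha\in\mathbb R^n\setminus\{0\}$ let $r_\alpha(x)=x-2\frac{\langle\alpha,x\rangle}{\|\alpha\|^2}\alpha$. A root system is a finite set $\mathcal R\subset\mathbb R^n\setminus\{0\}$ with $r_\alpha(\mathcal R)=\mathcal R$ and $\mathcal R\cap\mathbb R\alpha=\{\pm\alpha\}$ for all $\alpha\in\mathcal R$; it is normalized by $\|\alpha\|^2=2$ for all $\alpha\in\mathcal R$. $G$ is the finite group generated by the reflections $r_\alpha$, $\alpha\in\mathcal R$. A multiplicity function is a $G$-invariant function $k:\mathcal R\to\mathbb C$, $k_\alpha=k(\alpha)$; $k\ge0$ means $k_\alpha\ge0$ for all $\alpha$. $\mathcal R^+=\{\alpha\in\mathcal R:\langle\alpha,\beta\rangle>0\}$ is a fixed positive subsystem, where $\beta\in\mathbb R^n$ is not orthogonal to any root. Weighted measure: $dw_k(x)=\prod_{\alpha\in\mathcal R}|\langle\alpha,x\rangle|^{k_\alpha}dx=\prod_{\alpha\in\mathcal R^+}|\langle\alpha,x\rangle|^{2k_\alpha}dx$. With $c_k^{-1}=\int_{\mathbb R^n}e^{-\|x\|^2/2}\,dw_k(x)$, for $1\le p<\infty$ the space $L^p_k(\mathbb R^n)$ has norm $\|f\|_{L^p_k}=\left(c_k\int_{\mathbb R^n}|f|^p\,dw_k\right)^{1/p}$; $L^\infty_k$ is the usual one; the inner product of $L^2_k$ is the one inducing its norm. Dunkl operators: $T_jf(x)=\partial_jf(x)+\sum_{\alpha\in\mathcal R^+}k_\alpha\alpha_j\frac{f(x)-f(r_\alpha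 x)}{\langle\alpha,x\rangle}$, $j=1,\dots,n$. Dunkl Laplacian: $\Delta_k=\sum_{j=1}^nT_j^2$. Dunkl-Hermite operator: $\mathcal H_k=-\frac12(\Delta_k-\|x\|^2)$. $e^{-it\mathcal H_k}$, $t\in\mathbb R$, is the unitary group on $L^2_k(\mathbb R^n)$ generated by the self-adjoint realization of $\mathcal H_k$ (which has a complete orthonormal set of eigenfunctions of the form polynomial times $e^{-\|x\|^2/2}$), so $u(t,\cdot)=e^{-it\mathcal H_k}f$ solves $i\partial_tu-\mathcal H_ku=0$, $u(0,\cdot)=f$. The mixed norm $\|F\|_{L^q(I,L^p_k)}$ is the $L^q(I)$ norm (Lebesgue measure in $t\in I$) of $t\mapsto\|F(t,\cdot)\|_{L^p_k}$. Here $p$ is finite, and for $p=1$ the condition $2\gamma<\frac{n(p+1)}{p-1}$ is read as no restriction. *)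

(* Defs.v *)
From HB Require Import structures.
From mathcomp Require Import all_boot all_order all_algebra finmap.
From mathcomp.real_closed Require Import complex.
From mathcomp Require Import all_classical all_reals all_analysis.
From mathcomp Require Import measurable_realfun.
From mathcomp Require mpoly.

Set Implicit Arguments.
Unset Strict Implicit.
Unset Printing Implicit Defensive.
Import Order.TTheory GRing.Theory Num.Theory.
Import numFieldNormedType.Exports.

Local Open Scope classical_set_scope.
Local Open Scope ring_scope.

(* R^n is 'rV[R]_n, equipped with the sigma-algebra generated by the
   coordinate projections, i.e. the Borel sets. *)

Definition rV_display : measure_display -> measure_display.
Proof. exact. Qed.

Section measurable_rV.
Context {d} {T : measurableType d} {n : nat}.

Let coord (i : 'I_n) (x : 'rV[T]_n) : T := x ord0 i.

Let rV_set0 : g_sigma_preimage coord set0.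
Proof. exact: sigma_algebra0. Qed.

Let rV_setC A : g_sigma_preimage coord A -> g_sigma_preimage coord (~` A).
Proof. exact: sigma_algebraC. Qed.

Let rV_bigcup (F : (set 'rV[T]_n)^nat) :
  (forall i, g_sigma_preimage coord (F i)) ->
  g_sigma_preimage coord (\bigcup_i F i).
Proof. exact: sigma_algebra_bigcup. Qed.

HB.instance Definition _ := @isMeasurable.Build (rV_display d)
  'rV[T]_n (g_sigma_preimage coord) rV_set0 rV_setC rV_bigcup.

Lemma measurable_rV_coord (i : 'I_n) :
  measurable_fun [set: 'rV[T]_n] (fun x => x ord0 i).
Proof.
move=> _ Y mY; rewrite setTI; apply: sub_sigma_algebra => /=.
rewrite -bigcup_seq/=; exists i => /=; first by rewrite mem_index_enum.
by exists Y => //; rewrite setTI.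
Qed.

Lemma measurable_fun_rV d1 (T1 : measurableType d1) (f : T1 -> 'rV[T]_n) :
  (forall i, measurable_fun [set: T1] (fun x => f x ord0 i)) ->
  measurable_fun [set: T1] f.
Proof.
move=> mf; have H : g_sigma_preimage coord `<=`
    [set A | measurable (f @^-1` A)].
  apply: smallest_sub.
    split => /= [|A mA|F mF].
    - by rewrite preimage_set0.
    - by rewrite setTD preimage_setC; exact: measurableC.
    - by rewrite preimage_bigcup; exact: bigcup_measurable.
  rewrite -bigcup_seq/= => A [i _ [B mB <-]] /=; rewrite setTI.
  by rewrite -[X in measurable X]setTI; exact: (mf i).
by move=> _ A mA; rewrite setTI; exact: H.
Qed.

End measurable_rV.

Section lebesgue_rV.
Context {R : realType}.

Definition rV_cons n (z : measurableTypeR R * 'rV[R]_n) : 'rV[R]_n.+1 :=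
  row_mx (z.1%:M : 'rV_1) z.2.

Lemma measurable_rV_cons n : measurable_fun setT (@rV_cons n).
Proof.
apply: measurable_fun_rV => i.
have [j ->|j ->] := @split_ordP 1 n i.
  rewrite [X in measurable_fun _ X](_ : _ = fst) //.
  apply/funext => z; rewrite /rV_cons.
  by apply: etrans (row_mxEl _ _ _ _) _; rewrite mxE !ord1 eqxx mulr1n.
rewrite [X in measurable_fun _ X](_ : _ =
    (fun x : 'rV[R]_n => x ord0 j) \o snd); last first.
  by apply/funext => z; exact: row_mxEr.
by apply: measurableT_comp => //; exact: measurable_rV_coord.
Qed.

HB.instance Definition _ n := @isMeasurableFun.Build _ _ _ _
  (@rV_cons n) (@measurable_rV_cons n).

Section step.
Context n (m : {sigma_finite_measure set 'rV[R]_n -> \bar R}).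

Definition lebesgue_rVS : set 'rV[R]_n.+1 -> \bar R :=
  pushforward (@lebesgue_measure R \x m)%E (@rV_cons n).

Let lebesgue_rVS0 : lebesgue_rVS set0 = 0%E.
Proof. exact: measure0. Qed.

Let lebesgue_rVS_ge0 A : (0 <= lebesgue_rVS A)%E.
Proof. exact: measure_ge0. Qed.

Let lebesgue_rVS_sigma_additive : semi_sigma_additive lebesgue_rVS.
Proof. exact: measure_semi_sigma_additive. Qed.

HB.instance Definition _ := isMeasure.Build _ _ _ lebesgue_rVS
  lebesgue_rVS0 lebesgue_rVS_ge0 lebesgue_rVS_sigma_additive.

Let lebesgue_rVS_sigma_finite : sigma_finite setT lebesgue_rVS.
Proof.
pose g (x : 'rV[R]_n.+1) : measurableTypeR R * 'rV[R]_n :=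
  (x ord0 ord0, @rsubmx R 1 1 n x).
have mg : measurable_fun setT g.
  apply/measurable_fun_pairP; split; first exact: measurable_rV_coord.
  apply: measurable_fun_rV => i.
  rewrite [X in measurable_fun _ X](_ : _ =
      (fun x : 'rV[R]_n.+1 => x ord0 (rshift 1 i : 'I_n.+1))).
    exact: measurable_rV_coord.
  by apply/funext => x; rewrite /= mxE.
have gK : cancel (@rV_cons n) g.
  move=> [a v]; rewrite /g /rV_cons; congr pair; last exact: row_mxKr.
  have -> : ord0 = @lshift 1 n ord0 by apply/val_inj.
  by apply: etrans (row_mxEl _ _ _ _) _; rewrite mxE eqxx mulr1n.
have /sigma_finiteP[F [TF ndF Foo]] := sigma_finiteT (@lebesgue_measure R).
have /sigma_finiteP[G [TG ndG Goo]] := sigma_finiteT m.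
exists (fun i => g @^-1` (F i `*` G i)).
  rewrite -preimage_bigcup (_ : \bigcup_i _ = setT) ?preimage_setT//.
  rewrite -subTset => -[x y] _.
  have [i _ Fix] : (\bigcup_i F i) x by rewrite -TF.
  have [j _ Gjy] : (\bigcup_i G i) y by rewrite -TG.
  exists (maxn i j) => //; split.
  - by move: x Fix; exact/subsetPset/ndF/leq_maxl.
  - by move: y Gjy; exact/subsetPset/ndG/leq_maxr.
move=> i; have [? ?] := Foo i; have [? ?] := Goo i; split.
  by rewrite -[X in measurable X]setTI; apply: mg => //; exact: measurableX.
rewrite /lebesgue_rVS /pushforward -comp_preimage.
rewrite (_ : g \o _ = id); last by apply/funext => z; exact: gK.
by rewrite preimage_id product_measure1E// lte_mul_pinfty// ge0_fin_numE.
Qed.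

HB.instance Definition _ := @Measure_isSigmaFinite.Build _ _ _
  lebesgue_rVS lebesgue_rVS_sigma_finite.

End step.

Fixpoint lebesgue_rV n : {sigma_finite_measure set 'rV[R]_n -> \bar R} :=
  if n is n'.+1 then lebesgue_rVS (lebesgue_rV n')
  else @dirac _ _ (0 : 'rV[R]_0) R.

End lebesgue_rV.

Section root_systems.
Context {R : realType} {n : nat}.
Implicit Types (a b x y : 'rV[R]_n) (roots : {fset 'rV[R]_n}).
Implicit Types (k : 'rV[R]_n -> R).

(* The Euclidean inner product; the norm that the library puts on 'rV[R]_n
   is the sup norm, so Euclidean lengths are always written dot x x. *)
Definition dot x y : R := \sum_(i < n) x ord0 i * y ord0 i.

Definition reflection a x := x - (2 * (dot a x / dot a a)) *: a.

Record root_system roots : Prop := {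
  roots_neq0 : 0 \notin roots ;
  roots_stable : forall a, a \in roots ->
    [fset reflection a b | b in roots]%fset = roots ;
  roots_reduced : forall a, a \in roots -> forall b,
    (b \in roots /\ exists c : R, b = c *: a) <-> (b = a \/ b = - a) ;
  roots_normalized : forall a, a \in roots -> dot a a = 2 }.

(* Reflections are involutions, so closing under composition is enough. *)
Inductive reflection_group roots : ('rV[R]_n -> 'rV[R]_n) -> Prop :=
| reflection_group_id : reflection_group roots id
| reflection_group_comp a g : a \in roots -> reflection_group roots g ->
    reflection_group roots (reflection a \o g).

(* Only the values of k on the roots matter. *)
Definition multiplicity roots k : Prop :=
  forall g a, reflection_group roots g -> a \in roots -> k (g a) = k a.

Definition dunkl_gamma roots k : R := 2^-1 * \sum_(a <- roots) k a.

Definition regular roots b : Prop := forall a, a \in roots -> dot a b != 0.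

Definition positive_roots roots b : {fset 'rV[R]_n} :=
  [fset a in roots | 0 < dot a b]%fset.

Definition dunkl_weight roots k x : R :=
  \prod_(a <- roots) `|dot a x| `^ k a.

Lemma measurable_dot a : measurable_fun setT (dot a).
Proof.
apply: measurable_sum => i; apply: measurable_funM => //.
exact: measurable_rV_coord.
Qed.

Lemma measurable_dunkl_weight roots k :
  measurable_fun setT (dunkl_weight roots k).
Proof.
apply: measurable_prod => a _; apply: (measurableT_comp (measurable_powR _)).
by apply: measurableT_comp => //; exact: measurable_dot.
Qed.

Lemma dunkl_weight_ge0 roots k x : 0 <= dunkl_weight roots k x.
Proof. by apply: prodr_ge0 => a _; exact: powR_ge0. Qed.

End root_systems.

Section dunkl_measure.
Context {R : realType} {n : nat}.
Variables (roots : {fset 'rV[R]_n}) (k : 'rV[R]_n -> R).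

Definition dunkl_measure (A : set 'rV[R]_n) : \bar R :=
  (\int[lebesgue_rV n]_(x in A) (dunkl_weight roots k x)%:E)%E.

Let dunkl_measure0 : dunkl_measure set0 = 0%E.
Proof. by rewrite /dunkl_measure integral_set0. Qed.

Let dunkl_measure_ge0 A : (0 <= dunkl_measure A)%E.
Proof.
by apply: integral_ge0 => x _; rewrite lee_fin dunkl_weight_ge0.
Qed.

Let dunkl_measure_sigma_additive : semi_sigma_additive dunkl_measure.
Proof.
move=> /= F mF tF mUF; rewrite /dunkl_measure; apply: cvg_toP.
  apply: ereal_nondecreasing_is_cvgn => m p mp.
  apply: lee_sum_nneg_natr => // i _ _.
  by apply: integral_ge0 => /= x _; rewrite lee_fin dunkl_weight_ge0.
rewrite ge0_integral_bigcup//=.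
- apply: measurable_funTS; apply: measurableT_comp => //.
  exact: measurable_dunkl_weight.
- by move=> x _; rewrite lee_fin dunkl_weight_ge0.
Qed.

HB.instance Definition _ := isMeasure.Build _ _ _ dunkl_measure
  dunkl_measure0 dunkl_measure_ge0 dunkl_measure_sigma_additive.

Definition dunkl_c : R :=
  (fine (\int[dunkl_measure]_x (expR (- (dot x x / 2)))%:E))^-1.

Lemma dunkl_c_ge0 : 0 <= dunkl_c.
Proof.
by rewrite invr_ge0 fine_ge0// integral_ge0// => x _; rewrite lee_fin expR_ge0.
Qed.

(* L^p_k is L^p for the measure c_k w_k: its 'N[_]_p norm is
   (c_k \int |f|^p dw_k)^(1/p). *)
Definition dunkl_nmeasure : {measure set 'rV[R]_n -> \bar R} :=
  mscale (NngNum dunkl_c_ge0) dunkl_measure.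

Local Notation mu := dunkl_nmeasure.
Implicit Types f g : 'rV[R]_n -> R[i].

Definition L2norm f : \bar R :=
  ('N[mu]_(2%:E)[(fun x => (Normc.normc (f x))%:E)])%E.

Definition in_L2 f : Prop :=
  [/\ measurable_fun setT (fun x => complex.Re (f x)),
      measurable_fun setT (fun x => complex.Im (f x)) &
      (L2norm f < +oo)%E].

Definition L2inner f g : R[i] :=
  Complex (\int[mu]_x complex.Re (f x * conjc (g x)))
          (\int[mu]_x complex.Im (f x * conjc (g x))).

End dunkl_measure.

Section dunkl_operators.
Context {R : realType} {n : nat}.
Variables (roots : {fset 'rV[R]_n}) (k : 'rV[R]_n -> R) (b : 'rV[R]_n).
Implicit Types (f : 'rV[R]_n -> R[i]) (h : 'rV[R]_n -> R).

(* The positive subsystem is the one defined by b.  Off the null set of points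
   orthogonal to some root, where the quotient is x / 0 = 0, this is the usual
   formula. *)
Definition dunkl_op (j : 'I_n) h (x : 'rV[R]_n) : R :=
  'D_(delta_mx ord0 j) h x +
  \sum_(a <- positive_roots roots b)
    k a * a ord0 j * ((h x - h (reflection a x)) / dot a x).

Definition dunkl_laplacian h (x : 'rV[R]_n) : R :=
  \sum_(j < n) dunkl_op j (dunkl_op j h) x.

Definition dunkl_hermite h (x : 'rV[R]_n) : R :=
  - (2^-1 * (dunkl_laplacian h x - dot x x * h x)).

Definition poly_gauss (P : mpoly.mpoly n R) (x : 'rV[R]_n) : R :=
  mpoly.meval (fun i => x ord0 i) P * expR (- (dot x x / 2)).

Local Notation mu := (dunkl_nmeasure roots k).
Local Notation L2 := (in_L2 roots k).
Local Notation L2norm := (L2norm roots k).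
Local Notation inner := (L2inner roots k).

(* U t f is a representative of e^{-itH_k} f, for f in L^2_k: U is a strongly
   continuous one-parameter group of unitary operators of L^2_k whose generator
   extends -i H_k on the functions polynomial * e^{-|x|^2/2}.  These contain a
   complete orthonormal set of eigenfunctions of H_k, so H_k is essentially
   self-adjoint on them (and on their complex span, to which the last
   condition extends by linearity): by Stone's theorem, U is determined up to
   null sets and is generated by the self-adjoint realization of H_k. *)
Record dunkl_hermite_group (U : R -> ('rV[R]_n -> R[i]) -> ('rV[R]_n -> R[i])) :
    Prop := {
  group_L2 : forall t f, L2 f -> L2 (U t f) ;
  group_ae : forall t f g, L2 f -> L2 g ->
    f = g %[ae mu] -> U t f = U t g %[ae mu] ;
  group_linear : forall t (c : R[i]) f g, L2 f -> L2 g ->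
    U t (fun x => c * f x + g x) = (fun x => c * U t f x + U t g x) %[ae mu] ;
  group_isometry : forall t f g, L2 f -> L2 g ->
    inner (U t f) (U t g) = inner f g ;
  group_0 : forall f, L2 f -> U 0 f = f %[ae mu] ;
  group_D : forall s t f, L2 f -> U (s + t) f = U s (U t f) %[ae mu] ;
  group_continuous : forall f, L2 f ->
    L2norm (fun x => U t f x - f x) @[t --> (0 : R)] --> 0%E ;
  group_generator : forall P : mpoly.mpoly n R,
    let g x := (poly_gauss P x)%:C%C in
    L2norm (fun x => (t^-1)%:C%C * (U t g x - g x)
                     + 'i%C * (dunkl_hermite (poly_gauss P) x)%:C%C)
      @[t --> (0 : R)^'] --> 0%E }.

Definition orthonormal_system (f : nat -> 'rV[R]_n -> R[i]) : Prop :=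
  (forall j, L2 (f j)) /\ (forall i j, inner (f i) (f j) = (i == j)%:R).

End dunkl_operators.

Section mixed_norm.
Context {R : realType}.

Definition lr_norm (r : \bar R) (l : nat -> R[i]) : \bar R :=
  ('N[@counting nat R]_r[(fun j => (Normc.normc (l j))%:E)])%E.

(* |sum_j l_j |u_j|^2|, with value +oo where the partial sums diverge to
   infinity: the upper limit is the modulus of the sum of the series wherever
   the latter converges. *)
Definition density (T : Type) (l : nat -> R[i]) (u : nat -> T -> R[i])
    (x : T) : \bar R :=
  limn_esup (fun N : nat => (Normc.normc
    (\sum_(j < N) l j * (Normc.normc (u j x) ^+ 2)%:C%C))%:E).

Definition mixed_norm d (T : measurableType d)
    (mu : {measure set T -> \bar R}) (I : set (measurableTypeR R))
    (mI : measurable I) (q p : \bar R) (F : R -> T -> \bar R) : \bar R :=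
  ('N[mrestr (@lebesgue_measure R) mI]_q[(fun t => 'N[mu]_p[F t])])%E.

End mixed_norm.

(* Main.v *)
(* Let V_d be the space of polynomials of degree < d times exp (- |x|^2 / 2).
   The Dunkl-Hermite operator maps V_d into itself, so the group U leaves the
   closure of V_d invariant.  Every element of V_d has most of its mass in the
   ball |x|^2 <= A d, with A independent of d: extrapolating a polynomial along
   rays costs at most C^d, which a Gaussian tail absorbs.  Since V_(n N + 1)
   contains N^n independent monomials, there is an orthonormal sequence (f_j)
   with f_j in V_(n N + 1) for all j < N^n.  With lambda_j = (j + 1)^(- s), the
   density at any time t has mass at least N^(n (1 - s)) / 2 in a ball whose
   measure is of order N^(n / 2 + gamma), so by Hoelder its L^p norm is at least
   a constant times a power of N, with positive exponent exactly when s < 1 / r0,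
   where r0 is the critical value in the hypothesis on r.  Any s with
   1 / r < s < 1 / r0 works, and the L^p norm is infinite for every t. *)
Require Import Defs.
From HB Require Import structures.
From mathcomp Require Import all_boot all_order all_algebra finmap.
From mathcomp.real_closed Require Import complex.
From mathcomp Require Import all_classical all_reals all_analysis.
From mathcomp Require Import measurable_realfun ess_sup_inf ring lra.
From mathcomp Require mpoly.
Import -(notations) mpoly.

Set Implicit Arguments.
Unset Strict Implicit.
Unset Printing Implicit Defensive.
Import Order.TTheory GRing.Theory Num.Theory.
Import numFieldNormedType.Exports.

Local Open Scope classical_set_scope.
Local Open Scope ring_scope.

(** * Polynomial functions and Dunkl operators *)

(** The group is known only through its axioms: no kernel and no eigenfunction is at hand, and the
    generator is an L^2 limit at time 0 on polynomials times a Gaussian. Invariance is therefore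
    proved only up to arbitrarily small errors, by Euler's method on a finite generating family, and
    the concentration estimate has to hold uniformly over all polynomials of degree < d. The
    comparison of a polynomial with its dilates uses only the homogeneity of the measure, whose
    dimension is D = n + 2 gamma.

    The critical value arises as follows. A mass M on a set of measure V forces the p-th power of
    the L^p norm to be at least of order M^p V^(1 - p). With M of order N^(n (1 - s)) and V of order
    N^(D / 2), the exponent of N is n (1 - s) p - D (p - 1) / 2 = n p (1 / r0 - s). The first
    hypothesis says exactly that the denominator of r0 is positive. *)

Section polynomial_functions.
Context {R : realType} {n : nat}.
Implicit Types (d : nat) (f g : 'rV[R]_n -> R) (x : 'rV[R]_n).

(* [pol d f] : f is a polynomial function of degree < d, as for [size]. *)
Inductive pol : nat -> ('rV[R]_n -> R) -> Prop :=
| pol_zero d : pol d (fun _ => 0)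
| pol_cst d c : pol d.+1 (fun _ => c)
| polD d f g : pol d f -> pol d g -> pol d (fun x => f x + g x)
| polX d i f : pol d f -> pol d.+1 (fun x => x ord0 i * f x).

Lemma pol_le d e f : (d <= e)%N -> pol d f -> pol e f.
Proof.
move=> + pf; elim: pf e => {d f} [d|d c|d f g _ IHf _ IHg|d i f _ IHf] e de.
- exact: pol_zero.
- by case: e de => // e _; exact: pol_cst.
- by apply: polD; [exact: IHf|exact: IHg].
- by case: e de => // e de; apply: polX; exact: IHf.
Qed.

Lemma pol0_eq0 f x : pol 0 f -> f x = 0.
Proof.
move Ed : 0%N => d pf; elim: pf Ed => {d f} // d f g _ IHf _ IHg d0.
by rewrite IHf// IHg// addr0.
Qed.

Lemma polZ d c f : pol d f -> pol d (fun x => c * f x).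
Proof.
elim=> {d f} [d|d c'|d f g _ IHf _ IHg|d i f _ IHf].
- by under eq_fun do rewrite mulr0; exact: pol_zero.
- exact: pol_cst.
- by under eq_fun do rewrite mulrDr; exact: polD.
- by under eq_fun do rewrite mulrCA; exact: polX.
Qed.

Lemma polN d f : pol d f -> pol d (fun x => - f x).
Proof. by move=> /(polZ (-1)); under eq_fun do rewrite mulN1r. Qed.

Lemma polB d f g : pol d f -> pol d g -> pol d (fun x => f x - g x).
Proof. by move=> pf /polN; exact: polD. Qed.

Lemma pol_sum d (I : Type) (r : seq I) (F : I -> 'rV[R]_n -> R) :
  (forall i, pol d (F i)) -> pol d (fun x => \sum_(i <- r) F i x).
Proof.
move=> pF; elim: r => [|i r IHr].
  by under eq_fun do rewrite big_nil; exact: pol_zero.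
by under eq_fun do rewrite big_cons; exact: polD.
Qed.

Lemma pol_dot d a f : pol d f -> pol d.+1 (fun x => dot a x * f x).
Proof.
move=> pf; under eq_fun => x.
  rewrite /dot mulr_suml; under eq_bigr do rewrite -mulrA.
  over.
by apply: pol_sum => i; apply: polZ; exact: polX.
Qed.

Lemma pol_reflection d a f : pol d f -> pol d (fun x => f (reflection a x)).
Proof.
elim=> {d f} [d|d c|d f g _ IHf _ IHg|d i f _ IHf].
- exact: pol_zero.
- exact: pol_cst.
- exact: polD.
- rewrite (_ : (fun x => _) = (fun x =>
      x ord0 i * f (reflection a x) +
      (- (2 / dot a a * a ord0 i)) * (dot a x * f (reflection a x)))).
    by apply: polD; [exact: polX|apply: polZ; exact: pol_dot].
  by apply/funext => x; rewrite /reflection !mxE; ring.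
Qed.

(** The difference vanishes on the hyperplane orthogonal to a. For x_i f it equals x_i (f x - f (r
    x)) + (x_i - (r x)_i) f (r x), and x_i - (r x)_i = a_i (a . x) as |a|^2 = 2, so the quotient is
    built by induction. *)
Lemma pol_quotient d a f : dot a a = 2 -> pol d f ->
  exists2 g, pol d.-1 g &
    forall x, f x - f (reflection a x) = dot a x * g x.
Proof.
move=> aa2; elim=> {d f} [d|d c|d f g _ [f' pf' Ef] _ [g' pg' Eg]|d i f pf [f' pf' Ef]].
- exists (fun _ => 0); first exact: pol_zero.
  by move=> x; rewrite subr0 mulr0.
- exists (fun _ => 0); first exact: pol_zero.
  by move=> x; rewrite subrr mulr0.
- exists (fun x => f' x + g' x); first exact: polD.
  by move=> x; rewrite mulrDr -Ef -Eg; ring.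
(* [d.-1] truncates at 0, so counting the degree of x_i f' requires d > 0; for d = 0 the function f
   vanishes. *)
- case: d pf pf' => [|d] pf pf'.
    exists (fun _ => 0); first exact: pol_zero.
    by move=> x; rewrite !(pol0_eq0 _ pf) !mulr0 subr0.
  exists (fun x => x ord0 i * f' x + a ord0 i * f (reflection a x)).
    by apply: polD; [exact: polX|apply: polZ; exact: pol_reflection].
  move=> x; rewrite mulrDr [_ * (_ * f' x)]mulrCA -Ef.
  set u := f _; rewrite /reflection !mxE aa2; field.
  by [].
Qed.

Lemma pol_derive d (j : 'I_n) f : pol d f ->
  exists2 g, pol d.-1 g & forall x,
    is_derive (0 : R) (1 : R) (fun s : R => f (s *: delta_mx ord0 j + x)) (g x).
Proof.
elim=> {d f} [d|d c|d f g _ [f' pf' Df] _ [g' pg' Dg]|d i f pf [f' pf' Df]].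
- by exists (fun _ => 0) => [|x]; [exact: pol_zero|exact: is_derive_cst].
- by exists (fun _ => 0) => [|x]; [exact: pol_zero|exact: is_derive_cst].
- exists (fun x => f' x + g' x); first exact: polD.
  by move=> x; have := Df x; have := Dg x => ? ?; exact: is_deriveD.
- case: d pf pf' => [|d] pf pf'.
    exists (fun _ => 0); first exact: pol_zero.
    move=> x; under eq_fun do rewrite (pol0_eq0 _ pf) mulr0.
    exact: is_derive_cst.
  exists (fun x => (i == j)%:R * f x + x ord0 i * f' x).
    by apply: polD; [exact: polZ|exact: polX].
  move=> x; have := Df x => ?.
  pose c := (i == j)%:R : R.
  have Dx : is_derive (0 : R) (1 : R)
      (fun s : R => (s *: delta_mx ord0 j + x) ord0 i) c.
    under eq_fun do rewrite !mxE eqxx/= -/c.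
    have := is_deriveD (is_deriveZ c (is_derive_id (0 : R) (1 : R)))
      (is_derive_cst (x ord0 i : R) (0 : R) (1 : R)).
    rewrite addr0 [_ *: _]mulr1; congr (is_derive _ _ _ _).
    by apply/funext => s; rewrite /= [s * _]mulrC.
  have := is_deriveM Dx (Df x).
  congr (is_derive _ _ _ _); rewrite !scale0r !add0r addrC.
  by rewrite [_ *: c]mulrC.
Qed.

End polynomial_functions.

(** * Dunkl operators on polynomials times a Gaussian *)

Section gaussian_times_polynomial.
Context {R : realType} {n : nat}.
Implicit Types (d : nat) (f g h : 'rV[R]_n -> R) (a v x y : 'rV[R]_n).

Definition gauss x : R := expR (- (dot x x / 2)).

Lemma dotC x y : dot x y = dot y x.
Proof. by apply: eq_bigr => i _; rewrite mulrC. Qed.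

Lemma dotDr a x y : dot a (x + y) = dot a x + dot a y.
Proof.
by rewrite /dot -big_split; apply: eq_bigr => i _; rewrite mxE mulrDr.
Qed.

Lemma dotZr a c x : dot a (c *: x) = c * dot a x.
Proof. by rewrite /dot mulr_sumr; apply: eq_bigr => i _; rewrite mxE mulrCA. Qed.

Lemma dotDl a x y : dot (x + y) a = dot x a + dot y a.
Proof. by rewrite ![dot _ a]dotC dotDr. Qed.

Lemma dotZl a c x : dot (c *: x) a = c * dot x a.
Proof. by rewrite ![dot _ a]dotC dotZr. Qed.

Lemma dot_delta a j : dot a (delta_mx ord0 j) = a ord0 j.
Proof.
rewrite /dot (bigD1 j)//= mxE !eqxx mulr1 big1 ?addr0// => i /negPf ij.
by rewrite mxE eqxx ij mulr0.
Qed.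

Lemma dot_reflection a x y : dot a a = 2 ->
  dot (reflection a x) y = dot x (reflection a y).
Proof.
move=> aa; rewrite /reflection aa -[- (_ *: a) in LHS]scaleNr -[- (_ *: a) in RHS]scaleNr dotDl dotZl dotDr dotZr.
rewrite [dot x a]dotC. field.
by [].
Qed.

Lemma reflectionK a : dot a a = 2 -> involutive (reflection a).
Proof.
move=> aa x; rewrite /reflection aa -!(@scaleNr _ 'rV[R]_n) dotDr dotZr aa -addrA -scalerDl.
rewrite -[RHS]addr0 -(scale0r a); congr (_ + _ *: _). field.
by [].
Qed.

Lemma gauss_reflection a x : dot a a = 2 -> gauss (reflection a x) = gauss x.
Proof. by move=> aa; rewrite /gauss dot_reflection// reflectionK. Qed.

Lemma is_derive_gauss (j : 'I_n) x :
  is_derive (0 : R) (1 : R) (fun s : R => gauss (s *: delta_mx ord0 j + x))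
    (- (x ord0 j * gauss x)).
Proof.
have -> : (fun s : R => gauss (s *: delta_mx ord0 j + x)) = expR \o
    (fun s : R => - (dot x x / 2) + (- x ord0 j) * s + (- 2^-1) * (s * s)).
  apply/funext => s; rewrite /gauss /=; congr expR.
  rewrite dotDl !dotDr !dotZl !dotZr [dot (delta_mx _ _) x]dotC !dot_delta mxE !eqxx/=.
  field.
  by [].
have D1 : is_derive (0 : R) (1 : R)
    (fun s : R => - (dot x x / 2) + (- x ord0 j) * s + (- 2^-1) * (s * s)) (- x ord0 j).
  have := is_deriveD (is_deriveD (is_derive_cst (- (dot x x / 2)) (0 : R) (1 : R))
     (is_deriveZ (- x ord0 j) (is_derive_id (0 : R) (1 : R))))
     (is_deriveZ (- 2^-1) (is_deriveM (is_derive_id (0 : R) (1 : R)) (is_derive_id (0 : R) (1 : R)))).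
  by congr (is_derive _ _ _ _); rewrite /= !scale0r !addr0 scaler0 addr0 add0r [_ *: _]mulr1.
have := @is_derive1_comp R expR _ _ _ _ (is_derive_expR _) D1.
congr (is_derive _ _ _ _); rewrite /gauss mulr0 addr0 !mulr0 addr0.
by rewrite [LHS]mulrC mulNr.
Qed.

(** Reduces the directional derivatives in [dunkl_op] to functions of one real variable, for which
    the product and chain rules are used. *)
Lemma derive_line h x v (l : R) :
  is_derive (0 : R) (1 : R) (fun s : R => h (s *: v + x)) l -> 'D_v h x = l.
Proof.
move=> [_ <-]; rewrite /derive.
have -> : (fun s : R => s^-1 *: ((h \o shift x) (s *: v) - h x)) =
    (fun s : R => s^-1 *: (((fun s : R => h (s *: v + x)) \o shift 0) (s *: 1) -
      h (0 *: v + x))).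
  by apply/funext => s /=; rewrite addr0 [s *: 1]mulr1 scale0r add0r.
by [].
Qed.

Variables (roots : {fset 'rV[R]_n}) (k : 'rV[R]_n -> R) (b : 'rV[R]_n).
Hypothesis roots_sys : root_system roots.

(** On the root hyperplanes the quotients in [dunkl_op] take the default value 0, so polynomial
    formulas may fail there; they are stated off these null sets. *)
Definition off_walls x := forall a, a \in roots -> dot a x != 0.

Lemma off_walls_reflection a x :
  a \in roots -> off_walls x -> off_walls (reflection a x).
Proof.
move=> aR ox c cR; have aa := roots_normalized roots_sys aR.
rewrite -dot_reflection//; apply: ox.
by rewrite -(roots_stable roots_sys aR); apply: in_imfset.
Qed.

(** A derivative taken off the walls sees only points off the walls, so a function known only there
    can still be differentiated. *)
Lemma near_off_walls x v :
  off_walls x -> \forall s \near (0 : R), off_walls (s *: v + x).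
Proof.
move=> ox.
have wall a : a \in roots -> \forall s \near (0 : R), dot a (s *: v + x) != 0.
  move=> aR.
  have ca : (fun s : R => dot a (s *: v + x)) @ (0 : R) --> dot a x.
    under eq_fun do rewrite dotDr dotZr.
    have : (fun s : R => s * dot a v + dot a x) @ (0 : R) --> 0 * dot a v + dot a x.
      by apply: cvgD; [apply: cvgM; [exact: cvg_id|exact: cvg_cst]|exact: cvg_cst].
    by rewrite mul0r add0r.
  by have := cvgr_neq0 _ ca; apply; exact: ox.
have := @filter_bigI R _ roots (fun a s => dot a (s *: v + x) != 0) (nbhs (0 : R))
  (nbhs_filter (0 : R)) wall.
by apply: filterS => s H a aR; exact: H.
Qed.

(** The Gaussian is invariant under reflections, so the difference terms act on f alone and, like
    its derivative, lower the degree; differentiating the Gaussian gives - x_j f. The function h is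
    prescribed only off the walls because the operator is applied twice, and its first output is
    known only there. *)
Lemma dunkl_op_pol d (j : 'I_n) f : pol d f ->
  exists2 g, pol d.-1 g & forall h,
    (forall x, off_walls x -> h x = f x * gauss x) ->
    forall x, off_walls x ->
      dunkl_op roots k b j h x = (g x - x ord0 j * f x) * gauss x.
Proof.
move=> pf.
have [f' pf' Df] := pol_derive j pf.
have Q a : exists g : 'rV[R]_n -> R, pol d.-1 g /\
    (a \in positive_roots roots b ->
     forall x, f x - f (reflection a x) = dot a x * g x).
  have [|aP] := boolP (a \in positive_roots roots b); last first.
    by exists (fun _ => 0); split=> //; exact: pol_zero.
  rewrite !inE => /andP[aR _].
  by have [g pg Eg] := pol_quotient (roots_normalized roots_sys aR) pf; exists g.
have {Q} [g pg] := choice Q.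
exists (fun x => f' x + \sum_(a <- positive_roots roots b)
   (k a * a ord0 j) * g a x).
  by apply: polD => //; apply: pol_sum => a; apply: polZ; exact: (pg a).1.
move=> h Eh x ox; rewrite /dunkl_op.
have -> : 'D_(delta_mx ord0 j) h x = (f' x - x ord0 j * f x) * gauss x.
  apply: derive_line.
  have := is_deriveM (Df x) (is_derive_gauss j x).
  rewrite !scale0r !add0r => D0.
  have D1 := near_off_walls (delta_mx ord0 j) ox.
  have D2 : \forall s \near (0 : R),
      f (s *: delta_mx ord0 j + x) * gauss (s *: delta_mx ord0 j + x) =
      h (s *: delta_mx ord0 j + x).
    by move: D1; apply: filterS => s os; rewrite Eh.
  have := near_eq_is_derive D2 D0; congr (is_derive _ _ _ _).
  by rewrite /GRing.scale/=; ring.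
rewrite [in RHS]addrAC [RHS]mulrDl; congr (_ + _).
rewrite mulr_suml; apply: eq_big_seq => a aP.
have aR : a \in roots by move: aP; rewrite !inE => /andP[].
rewrite !Eh//; last exact: off_walls_reflection.
rewrite gauss_reflection ?(roots_normalized roots_sys)//.
rewrite -mulrBl (pg a).2// [dot _ _ * _]mulrC.
by have := ox a aR => a0; field.
Qed.

(** If T_j sends f to g_j - x_j f (Gaussian omitted), then T_j^2 sends it to g'_j - x_j g_j + x_j^2
    f. Summed over j, the last terms cancel against |x|^2 f, and what remains has no higher degree
    than f. *)
Lemma dunkl_hermite_pol d f : pol d.+1 f ->
  exists2 g, pol d.+1 g & forall h, (forall x, h x = f x * gauss x) ->
    forall x, off_walls x -> dunkl_hermite roots k b h x = g x * gauss x.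
Proof.
move=> pf.
have T1 j : exists g : 'rV[R]_n -> R, pol d g /\ forall h,
    (forall x, off_walls x -> h x = f x * gauss x) ->
    forall x, off_walls x ->
      dunkl_op roots k b j h x = (g x - x ord0 j * f x) * gauss x.
  by have [g] := dunkl_op_pol j pf; exists g.
have {T1} [g g1] := choice T1.
have T2 j : exists g2 : 'rV[R]_n -> R, pol d.+1 g2 /\ forall h,
    (forall x, off_walls x -> h x = (g j x - x ord0 j * f x) * gauss x) ->
    forall x, off_walls x ->
      dunkl_op roots k b j h x =
      (g2 x - x ord0 j * (g j x - x ord0 j * f x)) * gauss x.
  have pfj : pol d.+2 (fun x => g j x - x ord0 j * f x).
    apply: polB; last exact: polX.
    by apply: pol_le (g1 j).1; rewrite leqW.
  by have [g'] := dunkl_op_pol j pfj; exists g'.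
have {T2} [g' g2] := choice T2.
exists (fun x => - (2^-1) * \sum_(j < n) (g' j x - x ord0 j * g j x)).
  apply: polZ; apply: pol_sum => j; apply: polB; first exact: (g2 j).1.
  by apply: polX; exact: (g1 j).1.
move=> h Eh x ox; rewrite /dunkl_hermite /dunkl_laplacian.
under eq_bigr => j _.
  rewrite (g2 j).2//; last by move=> y oy; apply: (g1 j).2 => // z _; exact: Eh.
  over.
rewrite Eh -mulNr -[RHS]mulrA; congr (_ * _).
rewrite -mulr_suml [dot x x * _]mulrA -mulrBl; congr (_ * _).
rewrite /dot mulr_suml -sumrB; apply: eq_bigr => j _; ring.
Qed.

(** Bridge to the formal polynomials over which [group_generator] quantifies. *)
Lemma pol_meval d f : pol d f ->
  exists P : mpoly.mpoly n R, forall x, mpoly.meval (fun i => x ord0 i) P = f x.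
Proof.
elim=> {d f} [d|d c|d f g _ [P EP] _ [Q EQ]|d i f _ [P EP]].
- by exists (0 : mpoly.mpoly n R) => x; exact: mpoly.meval0.
- by exists (mpoly.mpolyC n c) => x; exact: mpoly.mevalC.
- by exists (P + Q) => x; rewrite mpoly.mevalD EP EQ.
- exists (mpoly.mpolyX R (mpoly.mnm1 i) * P) => x.
  by rewrite mpoly.mevalM EP mpoly.mevalXU.
Qed.

End gaussian_times_polynomial.

(** * Lebesgue measure on R^n *)

Section lebesgue_integral_rV.
Context {R : realType}.
Local Open Scope ereal_scope.
Local Notation leb n := (@lebesgue_rV R n).
Local Notation muR := (@lebesgue_measure R).

Lemma integral_lebesgue_rVS n (f : 'rV[R]_n.+1 -> \bar R) :
  measurable_fun setT f -> (forall x, 0 <= f x) ->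
  \int[leb n.+1]_x f x = \int[muR]_a \int[leb n]_v f (rV_cons (a, v)).
Proof.
move=> mf f0.
have -> : \int[leb n.+1]_x f x = \int[muR \x leb n]_z f (rV_cons z).
  rewrite /= ge0_integral_pushforward//=.
rewrite fubini_tonelli1//.
by apply: measurableT_comp => //; exact: measurable_rV_cons.
Qed.

Lemma measurable_rV_cons1 n a : measurable_fun setT (fun v : 'rV[R]_n => rV_cons (a, v)).
Proof.
by apply: measurableT_comp; [exact: measurable_rV_cons|exact: measurable_pair1].
Qed.

(** By uniqueness of Lebesgue measure: s times its image under x -> s x agrees with it on half-open
    intervals. *)
Lemma integral_lebesgue_scale (s : R) (f : measurableTypeR R -> \bar R) : (0 < s)%R ->
  measurable_fun setT f -> (forall x, 0 <= f x) ->
  \int[muR]_x f (s * x)%R = (s^-1)%:E * \int[muR]_x f x.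
Proof.
move=> s0 mf f0.
have s0' : (0 <= s)%R by exact: ltW.
have ms : @measurable_fun _ _ (measurableTypeR R) (measurableTypeR R) setT ( *%R s).
  exact: mulrl_measurable.
pose m := mscale (NngNum s0')
  (measure_function_pushforward__canonical__measure_function_Measure muR ms).
have mE A : measurable A -> muR A = m A.
  apply: lebesgue_measure_unique => _ [[a b]] _ <-.
  transitivity (s%:E * muR `](a / s)%R, (b / s)%R]); last first.
    congr (_ * muR _); apply/seteqP; split=> x /=;
    by rewrite !in_itv/= ltr_pdivrMr// ler_pdivlMr// [(x * s)%R]mulrC.
  rewrite !lebesgue_measure_itv/= !lte_fin ltr_pM2r ?invr_gt0//.
  case: ifPn => ab; last by rewrite mule0.
  by rewrite -!EFinB -EFinM -mulrBl mulrCA divff ?mulr1// gt_eqF.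
have -> : \int[muR]_x f x = s%:E * \int[muR]_x f (s * x)%R.
  rewrite (eq_measure_integral m) => [|A mA _]; last exact: mE.
  rewrite ge0_integral_mscale//= ge0_integral_pushforward//=.
by rewrite muleA -EFinM mulVf ?gt_eqF// mul1e.
Qed.

Lemma measurable_rV_scale n (s : R) : measurable_fun setT (fun x : 'rV[R]_n => s *: x)%R.
Proof.
apply: measurable_fun_rV => i; under eq_fun do rewrite mxE.
by apply: measurable_funM => //; exact: measurable_rV_coord.
Qed.

Lemma rV_consEl n (z : measurableTypeR R * 'rV[R]_n) (j : 'I_1) :
  rV_cons z ord0 (lshift n j : 'I_n.+1) = z.1.
Proof. by apply: etrans (row_mxEl _ _ _ _) _; rewrite mxE !ord1 eqxx mulr1n. Qed.

Lemma rV_consEr n (z : measurableTypeR R * 'rV[R]_n) (j : 'I_n) :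
  rV_cons z ord0 (rshift 1 j : 'I_n.+1) = z.2 ord0 j.
Proof. exact: row_mxEr. Qed.

Lemma rV_cons_scale n (s : R) a (v : 'rV[R]_n) :
  (s *: rV_cons (a, v) = rV_cons (s * a, s *: v))%R.
Proof.
apply/rowP => i; rewrite mxE; have [j ->|j ->] := @split_ordP 1 n i.
  by rewrite !rV_consEl.
by rewrite !rV_consEr mxE.
Qed.

Lemma integral_rV_scale n (s : R) (f : 'rV[R]_n -> \bar R) : (0 < s)%R ->
  measurable_fun setT f -> (forall x, 0 <= f x) ->
  \int[leb n]_x f (s *: x)%R = (s ^- n)%:E * \int[leb n]_x f x.
Proof.
move=> s0; elim: n f => [|n IHn] f mf f0.
  rewrite expr0 invr1 mul1e; apply: eq_integral => x _; congr f.
  by apply/rowP => -[].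
have mfs : measurable_fun setT (fun x : 'rV[R]_n.+1 => f (s *: x)%R).
  by apply: measurableT_comp => //; exact: measurable_rV_scale.
rewrite integral_lebesgue_rVS// integral_lebesgue_rVS//.
pose g a := \int[leb n]_v f (rV_cons (a, v)).
have g0 a : 0 <= g a by exact: integral_ge0.
have mg : measurable_fun setT g.
  apply: (@measurable_fun_fubini_tonelli_F _ _ _ _ _ (leb n) (f \o @rV_cons R n)).
    by apply: measurableT_comp => //; exact: measurable_rV_cons.
  by move=> x; exact: f0.
transitivity (\int[muR]_a ((s ^- n)%:E * g (s * a)%R)).
  apply: eq_integral => a _.
  under eq_integral do rewrite rV_cons_scale.
  rewrite (IHn (fun v => f (rV_cons (s * a, v)%R)))//.
  by apply: measurableT_comp => //; exact: measurable_rV_cons1.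
have ms : @measurable_fun _ _ (measurableTypeR R) (measurableTypeR R) setT ( *%R s).
  exact: mulrl_measurable.
have mgs : @measurable_fun _ _ (measurableTypeR R) _ setT (g \o *%R s) := measurableT_comp mg ms.
have gs0 (a : measurableTypeR R) : setT a -> 0 <= (g \o *%R s) a by move=> _; exact: g0.
have s0n : 0 <= (s ^- n)%:E by rewrite lee_fin invr_ge0 exprn_ge0// ltW.
have E1 := ge0_integralZl muR measurableT mgs gs0 s0n.
rewrite [LHS]E1.
have E2 := integral_lebesgue_scale s0 mg g0.
transitivity ((s ^- n)%:E * ((s^-1)%:E * \int[muR]_x g x)).
  by congr (_ * _); exact: E2.
rewrite muleA -EFinM; congr (_%:E * _).
by rewrite exprSr invfM mulrC.
Qed.

End lebesgue_integral_rV.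

(** * Zero sets of polynomials are null *)

Section null_sets.
Context {R : realType}.
Local Notation leb n := (@lebesgue_rV R n).
Local Notation muR := (@lebesgue_measure R).

Lemma finite_poly_zeros (p : {poly R}) : p != 0 -> finite_set [set a | p.[a] = 0].
Proof.
move=> p0; apply: contrapT => /(infinite_set_fset (size p))[B BA sB].
have := max_poly_roots p0 _ (fset_uniq B).
rewrite ltnNge sB => /(_ _)/negP; apply => //.
by apply/allP => a aB; apply/rootP; exact: BA.
Qed.

(** Views h as a polynomial in its first coordinate whose coefficients are polynomial functions of
    the others. *)
Lemma pol_sections n d (h : 'rV[R]_n.+1 -> R) : pol d h ->
  exists q : 'rV[R]_n -> {poly R}, (forall a v, h (rV_cons (a, v)) = (q v).[a]) /\
    (forall i, pol d (fun v => (q v)`_i)).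
Proof.
elim=> {d h} [d|d c|d f g _ [q [Eq pq]] _ [q' [Eq' pq']]|d i f _ [q [Eq pq]]].
- exists (fun _ => 0); split=> [a v|i]; first by rewrite horner0.
  by under eq_fun do rewrite coef0; exact: pol_zero.
- exists (fun _ => c%:P); split=> [a v|i]; first by rewrite hornerC.
  exact: pol_cst.
- exists (fun v => q v + q' v); split=> [a v|i]; first by rewrite hornerD Eq Eq'.
  by under eq_fun do rewrite coefD; exact: polD.
- have [j ->|j ->] := @split_ordP 1 n i.
    exists (fun v => 'X * q v); split=> [a v|l].
      by rewrite rV_consEl Eq hornerM hornerX.
    under eq_fun do rewrite coefXM.
    by case: l => [|l] /=; [exact: pol_zero|exact: pol_le (pq l)].
  exists (fun v : 'rV[R]_n => v ord0 j *: q v); split=> [a v|l].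
    by rewrite rV_consEr Eq hornerZ.
  by under eq_fun do rewrite coefZ; exact: polX.
Qed.

Lemma rV_cons_surj n (x : 'rV[R]_n.+1) : exists z, x = rV_cons z.
Proof.
exists (x ord0 (@lshift 1 n ord0 : 'I_n.+1), \row_j x ord0 (rshift 1 j : 'I_n.+1)).
apply/rowP => i; have [j ->|j ->] := @split_ordP 1 n i.
  by rewrite rV_consEl ord1.
by rewrite rV_consEr mxE.
Qed.

Lemma measurable_pol n d (h : 'rV[R]_n -> R) : pol d h -> measurable_fun setT h.
Proof.
elim=> {d h} // [d f g _ mf _ mg|d i f _ mf]; first exact: measurable_funD.
by apply: measurable_funM => //; exact: measurable_rV_coord.
Qed.

Lemma measurable_zeros n d (h : 'rV[R]_n -> R) : pol d h ->
  measurable [set x | h x = 0].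
Proof.
move=> /measurable_pol mh; rewrite -[X in measurable X]setTI.
by apply: (mh _ [set 0]).
Qed.

(** Induction on n: if some coefficient of the sections is not identically 0, it vanishes only on a
    null set of v, and for every other v the section is a nonzero univariate polynomial, with
    finitely many roots. Tonelli concludes. *)
Lemma pol_null n d (h : 'rV[R]_n -> R) : pol d h ->
  (forall x, h x = 0) \/ leb n [set x | h x = 0] = 0%E.
Proof.
elim: n d h => [|n IHn] d h ph.
  have [h0|h0] := eqVneq (h 0) 0.
    by left=> x; rewrite (_ : x = 0)//; apply/rowP => -[].
  right; rewrite /= diracE memNset//= => /eqP; exact/negP.
have [q [Eq pq]] := pol_sections ph.
have [q0|] := pselect (forall i v, (q v)`_i = 0).
  left=> x; have [[a v] ->] := rV_cons_surj x; rewrite Eq.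
  by rewrite (_ : q v = 0) ?horner0//; apply/polyP => i; rewrite coef0 q0.
move=> /existsNP[i /existsNP[v0 /eqP qv0]].
have [c0|c0] := IHn _ _ (pq i); first by rewrite c0 eqxx in qv0.
right; pose Z := [set x | h x = 0].
have mZ : measurable Z by exact: measurable_zeros ph.
have -> : leb n.+1 [set x | h x = 0] = (\int[leb n.+1]_x (\1_Z x)%:E)%E.
  by rewrite integral_indic// setIT.
have mI : measurable_fun setT (fun x => (\1_Z x)%:E : \bar R).
  by apply: measurableT_comp => //; exact: measurable_indic.
have I0 x : (0 <= (\1_Z x)%:E :> \bar R)%E by rewrite lee_fin.
rewrite (integral_lebesgue_rVS mI I0).
have mIc : measurable_fun setT (fun z => (\1_Z (@rV_cons R n z))%:E : \bar R).
  exact: (measurableT_comp mI (@measurable_rV_cons R n)).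
(* The order of integration is exchanged, so that the first coordinate a is integrated first, at
   fixed v. *)
have := @fubini_tonelli _ _ _ _ _ muR (leb n) (fun z => (\1_Z (rV_cons z))%:E).
rewrite /fubini_F /fubini_G => ->//.
rewrite (ge0_negligible_integral (N := [set v | (q v)`_i = 0]))//; last 3 first.
- exact: measurable_zeros (pq i).
- exact: (@measurable_fun_fubini_tonelli_G _ _ _ _ _ muR
    (fun z => (\1_Z (@rV_cons R n z))%:E) mIc (fun z => I0 _)).
- by move=> v _; apply: integral_ge0 => a _; rewrite lee_fin.
apply: integral0_eq => v [_ /= /eqP qvi].
have fin0 : finite_set [set a | (q v).[a] = 0].
  apply: finite_poly_zeros; apply: contra qvi => /eqP ->.
  by rewrite coef0.
transitivity (muR [set a | (q v).[a] = 0]).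
  rewrite -[X in muR X]setIT -integral_indic//.
    apply: eq_integral => a _; congr (_%:E); rewrite !indicE; congr (_%:R).
    congr nat_of_bool; apply/idP/idP; rewrite !inE /Z/= Eq//.
  apply: countable_measurable => [t|]; first exact: measurable_set1.
  exact: finite_set_countable.
exact/countable_lebesgue_measure0/finite_set_countable.
Qed.

End null_sets.

(** * Gaussian integrals and the Dunkl measure *)

Section gaussian_bounds.
Context {R : realType}.
Local Notation leb n := (@lebesgue_rV R n).
Local Notation muR := (@lebesgue_measure R).

Lemma dot_rV_cons n (z : measurableTypeR R * 'rV[R]_n) :
  dot (rV_cons z) (rV_cons z) = z.1 ^+ 2 + dot z.2 z.2.
Proof.
rewrite /dot big_ord_recl; congr (_ + _).
  have -> : ord0 = @lshift 1 n ord0 by apply/val_inj.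
  by rewrite rV_consEl expr2.
apply: eq_bigr => i _.
have -> : lift ord0 i = @rshift 1 n i by apply/val_inj.
by rewrite rV_consEr.
Qed.

Lemma dot_ge0 n (x : 'rV[R]_n) : 0 <= dot x x.
Proof. by apply: sumr_ge0 => i _; rewrite -expr2 sqr_ge0. Qed.

Lemma integral_gauss1 (c : R) : 0 < c ->
  (\int[muR]_x (expR (- (c * x ^+ 2)))%:E < +oo)%E.
Proof.
move=> c0; pose f (x : measurableTypeR R) : \bar R := (gauss_fun x)%:E.
have mf : measurable_fun setT f.
  by apply: measurableT_comp => //; exact: measurable_gauss_fun.
have f0 x : (0 <= f x)%E by rewrite lee_fin gauss_fun_ge0.
have s0 : 0 < Num.sqrt c by rewrite sqrtr_gt0.
have := integral_lebesgue_scale s0 mf f0.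
under eq_integral do rewrite /f /gauss_fun exprMn sqr_sqrtr ?ltW//.
move=> ->; rewrite integralT_gauss.
by rewrite -EFinM ltry.
Qed.

Lemma measurable_dotxx n : measurable_fun setT (fun x : 'rV[R]_n => dot x x).
Proof.
by apply: measurable_sum => i; apply: measurable_funM; exact: measurable_rV_coord.
Qed.

Lemma measurable_expR_dot n (c : R) :
  measurable_fun setT (fun x : 'rV[R]_n => expR (c * dot x x)).
Proof.
apply: measurableT_comp => //; apply: measurable_funM => //.
exact: measurable_dotxx.
Qed.

Lemma integral_gaussn n (c : R) : 0 < c ->
  (\int[leb n]_x (expR ((- c) * dot x x))%:E < +oo)%E.
Proof.
move=> c0; elim: n => [|n IHn].
  rewrite integral_dirac//=; last first.
    by apply: measurableT_comp => //; exact: measurable_expR_dot.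
  by rewrite diracT mul1e ltry.
have mf : measurable_fun setT (fun x : 'rV[R]_n.+1 => (expR ((- c) * dot x x))%:E).
  by apply: measurableT_comp => //; exact: measurable_expR_dot.
have f0 (x : 'rV[R]_n.+1) : (0 <= (expR ((- c) * dot x x))%:E)%E.
  by rewrite lee_fin expR_ge0.
rewrite (integral_lebesgue_rVS mf f0).
set A := (\int[leb n]_x _)%E in IHn.
have A0 : (0 <= A)%E by apply: integral_ge0 => x _; rewrite lee_fin expR_ge0.
have Afin : A \is a fin_num by rewrite ge0_fin_numE.
pose g (a : measurableTypeR R) : \bar R := (expR (- (c * a ^+ 2)))%:E.
have mg : measurable_fun setT g.
  have ms := @mulrl_measurable R setT (Num.sqrt c).
  have := measurableT_comp measurable_gauss_fun ms.
  move=> /(measurableT_comp (@EFin_measurable R setT)); congr (measurable_fun _ _).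
  by apply/funext => a; rewrite /g/= /gauss_fun exprMn sqr_sqrtr ?ltW.
have g0 (a : measurableTypeR R) : setT a -> (0 <= g a)%E.
  by move=> _; rewrite lee_fin expR_ge0.
have -> : (\int[muR]_a \int[leb n]_v (expR ((- c) * dot (rV_cons (a, v)) (rV_cons (a, v))))%:E
    = \int[muR]_a (A * g a))%E.
  apply: eq_integral => a _.
  have mv : measurable_fun setT (fun v : 'rV[R]_n => (expR (- c * dot v v))%:E).
    by apply: measurableT_comp => //; exact: measurable_expR_dot.
  have v0 (v : 'rV[R]_n) : setT v -> (0 <= (expR (- c * dot v v))%:E)%E.
    by move=> _; rewrite lee_fin expR_ge0.
  have a0 : (0 <= g a)%E by rewrite lee_fin expR_ge0.
  rewrite muleC -(ge0_integralZl (leb n) measurableT mv v0 a0).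
  by apply: eq_integral => v _; rewrite /g dot_rV_cons/= mulrDr expRD EFinM mulNr.
have E1 := ge0_integralZl muR measurableT mg g0 A0.
rewrite [X in (X < _)%E]E1 lte_mul_pinfty//.
exact: integral_gauss1.
Qed.

Lemma pol_bound n d (f : 'rV[R]_n -> R) (e : R) : 0 < e -> pol d f ->
  exists2 C, 0 <= C & forall x, `|f x| <= C * expR (e * dot x x).
Proof.
move=> + pf; elim: pf e => {d f} [d|d c|d f g _ IHf _ IHg|d i f _ IHf] e e0.
- by exists 0 => // x; rewrite normr0 mul0r.
- exists `|c| => // x; rewrite ler_peMr// -expR0 ler_expR.
  by rewrite mulr_ge0 ?dot_ge0// ltW.
- have [C C0 fC] := IHf _ e0; have [C' C'0 gC'] := IHg _ e0.
  exists (C + C') => [|x]; first exact: addr_ge0.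
  by rewrite (le_trans (ler_normD _ _))// mulrDl lerD.
- have e20 : 0 < e / 2 by rewrite divr_gt0.
  have [C C0 fC] := IHf _ e20.
  (* Half of the rate e pays for f, the other half for the coordinate: |x_i| <= 1 + y <= (1 + 2 / e)
     (1 + (e / 2) y), where y = |x|^2. *)
  exists ((1 + 2 / e) * C) => [|x]; first by rewrite mulr_ge0// addr_ge0// divr_ge0// ltW.
  rewrite normrM [X in expR (X * _)](splitr e) [(e / 2 + e / 2) * _]mulrDl expRD mulrACA ler_pM//.
  have xi : `|x ord0 i| <= 1 + dot x x.
    have : x ord0 i ^+ 2 <= dot x x.
      rewrite /dot (bigD1 i)//= -expr2 lerDl sumr_ge0// => j _.
      by rewrite -expr2 sqr_ge0.
    rewrite -(real_normK (num_real (x ord0 i))).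
    by have := normr_ge0 (x ord0 i); nra.
  apply: (le_trans xi).
  have E1 : 1 + e / 2 * dot x x <= expR (e / 2 * dot x x) := expR_ge1Dx _.
  apply: le_trans (_ : (1 + 2 / e) * (1 + e / 2 * dot x x) <= _); last first.
    by rewrite ler_wpM2l// addr_ge0// divr_ge0// ltW.
  have -> : (1 + 2 / e) * (1 + e / 2 * dot x x) = 1 + dot x x + e / 2 * dot x x + 2 / e.
    by field; rewrite gt_eqF.
  have := dot_ge0 x; have : 0 < 2 / e by rewrite divr_gt0.
  nra.
Qed.

End gaussian_bounds.

(** * Integration, positivity and homogeneity of the Dunkl measure *)

Section dunkl_measure_facts.
Context {R : realType} {n : nat}.
Variables (roots : {fset 'rV[R]_n}) (k : 'rV[R]_n -> R).
Hypothesis roots_sys : root_system roots.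
Hypothesis k_ge0 : forall a, a \in roots -> 0 <= k a.
Local Notation leb := (@lebesgue_rV R n).
Local Notation w := (dunkl_weight roots k).
Local Notation nu := (dunkl_measure roots k).
Local Notation mu := (dunkl_nmeasure roots k).
Local Notation c := (dunkl_c roots k).

Lemma measurable_gauss : measurable_fun setT (@gauss R n).
Proof.
rewrite (_ : gauss = fun x => expR (- (2^-1) * dot x x)).
  exact: measurable_expR_dot.
by apply/funext => x; rewrite /gauss mulNr mulrC.
Qed.

Lemma weight_bound (e : R) : 0 < e ->
  exists2 C, 0 <= C & forall x, w x <= C * expR (e * dot x x).
Proof.
rewrite /dunkl_weight; have : forall a, a \in enum_fset roots -> 0 <= k a by exact: k_ge0.
elim: (enum_fset roots) e => [|a s IHs] e ks e0.
  exists 1 => // x; rewrite big_nil mul1r -expR0 ler_expR.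
  by rewrite mulr_ge0 ?dot_ge0// ltW.
have ka : 0 <= k a by rewrite ks// mem_head.
have e20 : 0 < e / 2 by rewrite divr_gt0.
have [C C0 sC] := IHs _ (fun b bs => ks b (mem_behead (s := a :: s) bs)) e20.
(* Raising to the power k a multiplies this rate by k a, which leaves at most e / 2; the + 1 covers
   k a = 0. *)
have e30 : 0 < e / 2 / (k a + 1) by rewrite divr_gt0// ltr_wpDl.
have pa : pol 2 (fun x : 'rV[R]_n => dot a x * 1) by apply: pol_dot; exact: pol_cst.
have [C' C'0 aC] := pol_bound e30 pa.
exists (C' `^ k a * C) => [|x]; first by rewrite mulr_ge0// powR_ge0.
rewrite big_cons [X in expR (X * _)](splitr e) [(e / 2 + e / 2) * _]mulrDl expRD.
rewrite mulrACA ler_pM ?powR_ge0//; first by apply: prodr_ge0 => *; exact: powR_ge0.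
have := aC x; rewrite mulr1 => {}aC.
apply: (le_trans (ge0_ler_powR ka _ _ aC)).
- by rewrite nnegrE.
- by rewrite nnegrE mulr_ge0// expR_ge0.
rewrite powRM ?expR_ge0// ler_wpM2l ?powR_ge0//.
rewrite -expRM ler_expR.
rewrite mulrAC ler_wpM2r ?dot_ge0//.
rewrite mulrAC ler_pdivrMr ?ltr_wpDl//.
by nra.
Qed.

Import HBNNSimple.

Lemma integral_dunkl_measure (f : 'rV[R]_n -> \bar R) :
  measurable_fun setT f -> (forall x, 0 <= f x)%E ->
  (\int[nu]_x f x = \int[leb]_x (f x * (w x)%:E))%E.
Proof.
move=> mf f0.
have mw : measurable_fun setT (fun x => (w x)%:E).
  by apply: measurableT_comp => //; exact: measurable_dunkl_weight.
have w0 x : (0 <= (w x)%:E)%E by rewrite lee_fin dunkl_weight_ge0.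
pose f_ := nnsfun_approx measurableT mf.
transitivity (limn (fun m => \int[nu]_x (f_ m x)%:E)%E).
  rewrite -monotone_convergence//=.
  - apply: eq_integral => x _; apply/esym/cvg_lim => //=.
    by apply: cvg_nnsfun_approx.
  - by move=> m; apply: measurableT_comp.
  - by move=> m x _; rewrite lee_fin.
  - by move=> x _ i j ij; rewrite lee_fin//; exact/lefP/nd_nnsfun_approx.
transitivity (limn (fun m => \int[leb]_x ((f_ m x)%:E * (w x)%:E))%E); last first.
  rewrite -monotone_convergence//=.
  - apply: eq_integral => x _; apply/cvg_lim => //=.
    apply: cvgeZr => //.
    by apply: cvg_nnsfun_approx.
  - move=> m; apply: emeasurable_funM => //; apply: measurableT_comp => //.
  - by move=> m x _; rewrite mule_ge0// lee_fin.
  - move=> x _ i j ij; rewrite lee_wpmul2r// lee_fin//; exact/lefP/nd_nnsfun_approx.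
congr (limn _); apply/funext => m.
under [LHS]eq_integral do rewrite fimfunE -fsumEFin//.
rewrite ge0_integral_fsum//; last 2 first.
- by move=> r; apply/measurable_EFinP; do 2 apply/measurableT_comp => //.
- by move=> r x _; rewrite EFinM nnfun_muleindic_ge0.
under [RHS]eq_integral.
  move=> x _; rewrite fimfunE -fsumEFin// ge0_mule_fsuml; last first.
    by move=> r; rewrite EFinM nnfun_muleindic_ge0.
  over.
rewrite [RHS]ge0_integral_fsum//; last 2 first.
- move=> r; apply: emeasurable_funM => //.
  by apply/measurable_EFinP; do 2 apply/measurableT_comp => //.
- by move=> r x _; rewrite mule_ge0// EFinM nnfun_muleindic_ge0.
apply: eq_fsbigr => r _.
rewrite integralZl_indic_nnsfun//= integral_indic// setIT.
(* If the level set is empty, both sides vanish; otherwise r is a value of a nonnegative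
   function. *)
have [A0|] := eqVneq (f_ m @^-1` [set r]) set0.
  rewrite A0 measure0 mule0 integral0_eq// => x _.
  by rewrite indic0 mulr0 mul0e.
move=> /set0P[y yr]; have r0 : (0 <= r)%R by rewrite -yr.
have mA : measurable (f_ m @^-1` [set r]) by [].
rewrite /= /dunkl_measure [X in (_ * X)%E]integral_mkcond -ge0_integralZl//=.
- apply: eq_integral => x _; rewrite patchE indicE EFinM.
  by case: ifPn => _; rewrite ?mule1 ?mule0 ?mul0e// !muleA !mule1.
- by apply/(measurable_restrict _ _ _) => //; exact: measurable_funTS.
- by move=> x _; rewrite patchE; case: ifPn.
Qed.

Lemma ge0_integral_dunkl_nmeasure (f : 'rV[R]_n -> \bar R) :
  measurable_fun setT f -> (forall x, 0 <= f x)%E ->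
  (\int[mu]_x f x = c%:E * \int[leb]_x (f x * (w x)%:E))%E.
Proof.
by move=> mf f0; rewrite ge0_integral_mscale// integral_dunkl_measure.
Qed.

Lemma integral_gauss_nu (a : R) : 0 < a ->
  (\int[nu]_x (expR ((- a) * dot x x))%:E < +oo)%E.
Proof.
move=> a0.
have me b : measurable_fun setT (fun x : 'rV[R]_n => (expR (b * dot x x))%:E).
  by apply: measurableT_comp => //; exact: measurable_expR_dot.
have e0 b (x : 'rV[R]_n) : (0 <= (expR (b * dot x x))%:E)%E by rewrite lee_fin expR_ge0.
have mw : measurable_fun setT (fun x => (w x)%:E).
  by apply: measurableT_comp => //; exact: measurable_dunkl_weight.
rewrite integral_dunkl_measure//.
have a20 : 0 < a / 2 by rewrite divr_gt0.
have [C C0 wC] := weight_bound a20.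
apply: le_lt_trans (_ : \int[leb]_x (C%:E * (expR ((- (a / 2)) * dot x x))%:E) < _)%E.
  apply: ge0_le_integral => //=.
  - by move=> x _; rewrite mule_ge0// lee_fin dunkl_weight_ge0.
  - exact: emeasurable_funM.
  - by apply: emeasurable_funM => //; exact: me.
  move=> x _; rewrite -!EFinM lee_fin mulrC.
  apply: (le_trans (ler_wpM2r (expR_ge0 _) (wC x))).
  rewrite -[leLHS]mulrA -expRD -mulrDl; apply: ler_wpM2l => //.
  rewrite ler_expR le_eqVlt; apply/orP; left; apply/eqP; congr (_ * _).
  by field.
rewrite (ge0_integralZl leb measurableT (me (- (a / 2))) (fun x _ => e0 _ x))//.
by apply: lte_mul_pinfty => //; exact: integral_gaussn.
Qed.

Lemma lebesgue_rV_setT_neq0 m : @lebesgue_rV R m setT != 0%E.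
Proof.
elim: m => [|m IHm]; first by rewrite /= diracT eqe oner_eq0.
have := @integral_lebesgue_rVS R m (cst 1%E) (measurable_cst _) (fun _ => lee01).
rewrite integral_cst// mul1e => ->.
under eq_integral do rewrite integral_cst// mul1e.
rewrite integral_cst// /= mule_eq0 negb_or IHm/=.
rewrite -set_itvE [X in X != _](_ : _ = +oo%E)//.
exact: (lebesgue_measure_itv `]-oo, +oo[).
Qed.

Lemma pol_neq0_ae d (h : 'rV[R]_n -> R) x0 : pol d h -> h x0 != 0 ->
  {ae leb, forall x, h x != 0}.
Proof.
move=> ph h0; have [hE|hn] := pol_null ph; first by rewrite hE eqxx in h0.
exists [set x | h x = 0]; split=> //; first exact: measurable_zeros ph.
by move=> x /= /negP; rewrite negbK => /eqP.
Qed.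

Lemma off_walls_ae : {ae leb, forall x, off_walls roots x}.
Proof.
have wall a : a \in roots -> {ae leb, forall x, dot a x != 0}.
  move=> aR.
  have pa : pol 2 (fun x : 'rV[R]_n => dot a x * 1) by apply: pol_dot; exact: pol_cst.
  have := @pol_neq0_ae _ _ a pa; rewrite mulr1 (roots_normalized roots_sys)//.
  rewrite pnatr_eq0 => /(_ isT); apply: filterS => x.
  by rewrite mulr1.
have := @filter_bigI _ _ roots (fun a x => dot a x != 0) (almost_everywhere leb) _ wall.
by apply; apply: filterS => x H a aR; exact: H.
Qed.

Lemma ae_dunkl_nmeasure (P : 'rV[R]_n -> Prop) :
  {ae leb, forall x, P x} -> {ae mu, forall x, P x}.
Proof.
move=> [B [mB B0 PB]]; exists B; split=> //.
rewrite /= /mscale/= /dunkl_measure null_set_integral ?mule0//.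
by apply: measurable_funTS; apply: measurableT_comp => //; exact: measurable_dunkl_weight.
Qed.

(** If the integral were 0, the integrand times the weight would vanish almost everywhere. It is
    nonzero off the walls and off the zeros of h, so the whole space would be null. *)
Lemma integral_pol_gt0 d (h g : 'rV[R]_n -> R) x0 : pol d h -> h x0 != 0 ->
  measurable_fun setT g -> (forall x, 0 < g x) ->
  (0 < \int[nu]_x (h x ^+ 2 * g x)%:E)%E.
Proof.
move=> ph h0 mg g0.
have mh := measurable_pol ph.
have mhg : measurable_fun setT (fun x => (h x ^+ 2 * g x)%:E).
  apply: measurableT_comp => //; apply: measurable_funM => //.
  exact: measurable_funX.
have mw : measurable_fun setT (fun x => (w x)%:E).
  by apply: measurableT_comp => //; exact: measurable_dunkl_weight.
have hg0 x : (0 <= (h x ^+ 2 * g x)%:E)%E.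
  by rewrite lee_fin mulr_ge0 ?sqr_ge0// ltW.
have F0 x : (0 <= (h x ^+ 2 * g x)%:E * (w x)%:E)%E.
  by rewrite mule_ge0// lee_fin dunkl_weight_ge0.
rewrite integral_dunkl_measure// lt0e integral_ge0// andbT.
apply/eqP => I0.
have : (\int[leb]_x `|(h x ^+ 2 * g x)%:E * (w x)%:E| = 0)%E.
  by rewrite -[RHS]I0; apply: eq_integral => x _; rewrite gee0_abs.
move=> /(ae_eq_integral_abs leb measurableT (emeasurable_funM mhg mw)).
move=> /(filterI off_walls_ae) /(filterI (pol_neq0_ae ph h0)) [B [mB B0 PB]].
have := lebesgue_rV_setT_neq0 n.
rewrite (_ : setT = B) ?B0 ?eqxx//; apply/esym; rewrite -subTset.
apply: subset_trans PB => x _ /= [hx [ox /(_ I)]].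
move=> /eqP; rewrite -EFinM eqe mulf_eq0 mulf_eq0 sqrf_eq0 (negbTE hx) gt_eqF//=.
rewrite /dunkl_weight prodf_seq_eq0 => /hasP[a aR /=].
by rewrite powR_eq0 normr_eq0 (negbTE (ox a aR)).
Qed.

(** Both bounds on the Gaussian integral are at stake: were it 0 or +oo, [fine] and the inverse
    would return 0. *)
Lemma dunkl_c_gt0 : 0 < c.
Proof.
rewrite invr_gt0 fine_gt0//; apply/andP; split.
  have := @integral_pol_gt0 1 (cst 1) gauss 0 (pol_cst _ _) _ measurable_gauss.
  rewrite oner_eq0 => /(_ isT (fun x => expR_gt0 _)).
  by under eq_integral do rewrite expr1n mul1r.
have a0 : 0 < 2^-1 :> R by [].
have := integral_gauss_nu a0.
by under eq_integral do rewrite mulNr mulrC.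
Qed.

Lemma dunkl_weight_scale s x : 0 < s ->
  w (s *: x) = s `^ (2 * dunkl_gamma roots k) * w x.
Proof.
move=> s0; rewrite /dunkl_gamma mulrA divff// mul1r /dunkl_weight.
have s0' := ltW s0.
elim: (enum_fset roots) => [|a r IHr]; first by rewrite !big_nil powRr0 mulr1.
rewrite !big_cons IHr dotZr normrM ger0_norm// powRM// powRD; last first.
  by apply/implyP => _; rewrite gt_eqF.
by rewrite mulrACA.
Qed.

(** The homogeneous dimension of the measure: dilating a set by s multiplies its measure by s^D. *)
Definition dunkl_dim : R := n%:R + 2 * dunkl_gamma roots k.

Lemma integral_dunkl_scale s (f : 'rV[R]_n -> \bar R) : 0 < s ->
  measurable_fun setT f -> (forall x, 0 <= f x)%E ->
  (\int[mu]_x f (s *: x) = (s `^ (- dunkl_dim))%:E * \int[mu]_x f x)%E.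
Proof.
move=> s0 mf f0.
have mfs : measurable_fun setT (fun x : 'rV[R]_n => f (s *: x)).
  by apply: measurableT_comp => //; exact: measurable_rV_scale.
have mw : measurable_fun setT (fun x => (w x)%:E).
  by apply: measurableT_comp => //; exact: measurable_dunkl_weight.
have w0 x : (0 <= (w x)%:E)%E by rewrite lee_fin dunkl_weight_ge0.
rewrite !ge0_integral_dunkl_nmeasure// muleCA; congr (_ * _)%E.
pose F x : \bar R := (f x * (w x)%:E)%E.
have mF : measurable_fun setT F by exact: emeasurable_funM.
have F0 x : (0 <= F x)%E by rewrite mule_ge0.
have := integral_rV_scale s0 mF F0.
pose sg := s `^ (2 * dunkl_gamma roots k).
have sg0 : 0 < sg by rewrite powR_gt0.
have -> : (\int[leb]_x F (s *: x) = sg%:E * \int[leb]_x (f (s *: x) * (w x)%:E))%E.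
  rewrite -ge0_integralZl//=.
  - apply: eq_integral => x _; rewrite /F dunkl_weight_scale// EFinM.
    by rewrite muleCA.
  - exact: emeasurable_funM.
  - by move=> x _; rewrite mule_ge0.
  - by rewrite lee_fin ltW.
move=> E.
have -> : s `^ (- dunkl_dim) = sg^-1 * s ^- n.
  rewrite powRN powRD; last by apply/implyP => _; rewrite gt_eqF.
  by rewrite powR_mulrn ?ltW// invfM mulrC.
by rewrite EFinM -muleA -[X in (_ * X)%E]E muleA -EFinM mulVf ?gt_eqF// mul1e.
Qed.

End dunkl_measure_facts.

(** * Tails of polynomials times a Gaussian *)

Lemma leq_bin_exp2 m j : ('C(m, j) <= 2 ^ m)%N.
Proof.
elim: m j => [|m IHm] [|j] //; first by rewrite bin0 expn_gt0.
by rewrite binS expnS mul2n -addnn leq_add.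
Qed.

(** * Extrapolation by Newton's forward differences *)

Section newton_differences.
Context {R : realType}.
Implicit Type u : nat -> R.

Definition fwd_diff u : nat -> R := fun i => u i.+1 - u i.

Lemma newton_expansion u m :
  u m = \sum_(j < m.+1) 'C(m, j)%:R * iter j fwd_diff u 0%N.
Proof.
elim: m u => [|m IHm] u; first by rewrite big_ord1 bin0 mul1r.
have -> : u m.+1 = u m + fwd_diff u m by rewrite /fwd_diff addrC subrK.
rewrite (IHm u) (IHm (fwd_diff u)).
rewrite [RHS]big_ord_recl/= bin0 mul1r.
under [in RHS]eq_bigr => j _ do rewrite /bump/= add1n binS natrD mulrDl.
rewrite big_split/= addrA; congr (_ + _); last first.
  apply: eq_bigr => j _; congr (_ * _).
  by rewrite -iterS -iterSr.
rewrite big_ord_recl bin0 mul1r/=; congr (_ + _).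
rewrite [in RHS]big_ord_recr/= bin_small// mul0r addr0.
by apply: eq_bigr.
Qed.

(** By (y - z)^2 <= 2 y^2 + 2 z^2, where both differences of order m use values from the same
    enlarged window: a factor 4 per order. *)
Lemma iter_fwd_diff_sqr u m i :
  (iter m fwd_diff u i) ^+ 2 <= 4 ^+ m * \sum_(j < m.+1) u (i + j)%N ^+ 2.
Proof.
elim: m i => [|m IHm] i; first by rewrite big_ord1 addn0 mul1r.
rewrite iterS {1}/fwd_diff; set S := \sum_(j < m.+2) _.
have S1 : \sum_(j < m.+1) u (i.+1 + j)%N ^+ 2 <= S.
  rewrite /S [leRHS]big_ord_recl/= ler_wpDl ?sqr_ge0//.
  by apply: ler_sum => j _; rewrite /bump/= addnA addn1.
have S2 : \sum_(j < m.+1) u (i + j)%N ^+ 2 <= S.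
  by rewrite /S [leRHS]big_ord_recr/= ler_wpDr ?sqr_ge0.
have m4 : 0 <= 4 ^+ m :> R by rewrite exprn_ge0.
have := le_trans (IHm i) (ler_wpM2l m4 S2).
have := le_trans (IHm i.+1) (ler_wpM2l m4 S1).
rewrite [4 ^+ m.+1]exprS; set v := iter m fwd_diff u; set p := 4 ^+ m.
have := sqr_ge0 (v i.+1 + v i).
nra.
Qed.

(** Newton's expansion of u (2 d) stops before order d. The square of its d terms costs d^2 <= 4^d,
    the binomials 16^d and the differences 4^d, in total 256^d = 4^(4 d). *)
Lemma newton_extrapolation u d : (forall i, iter d fwd_diff u i = 0) ->
  u (2 * d)%N ^+ 2 <= 4 ^+ (4 * d) * \sum_(j < d) u j ^+ 2.
Proof.
move=> ud; rewrite exprM (_ : 4 ^+ 4 = 256 :> R); last by rewrite -natrX.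
 set S := \sum_(j < d) _.
have S0 : 0 <= S by apply: sumr_ge0 => j _; exact: sqr_ge0.
have vanish j : (d <= j)%N -> iter j fwd_diff u 0%N = 0.
  move=> dj; rewrite -(subnK dj); elim: (j - d)%N 0%N => [|l IHl] i; first exact: ud.
  by rewrite addSn iterS /fwd_diff !IHl subrr.
have -> : u (2 * d)%N = \sum_(j < d) 'C(2 * d, j)%:R * iter j fwd_diff u 0%N.
  rewrite newton_expansion -!(big_mkord xpredT (fun j => 'C(2 * d, j)%:R * iter j fwd_diff u 0%N)).
  rewrite (@big_cat_nat _ _ _ d)//=; last by rewrite ltnW// ltnS leq_pmull.
  rewrite [X in _ + X]big1_seq ?addr0// => j /andP[_].
  by rewrite mem_index_iota => /andP[dj _]; rewrite vanish// mulr0.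
have cs (m : nat) (F : nat -> R) (M : R) : (forall j, (j < m)%N -> F j ^+ 2 <= M) ->
    (\sum_(j < m) F j) ^+ 2 <= m%:R ^+ 2 * M.
  move=> FM; have [->|m0] := posnP m; first by rewrite big_ord0 !expr0n/= mul0r.
  have M0 : 0 <= M by rewrite (le_trans (sqr_ge0 (F 0%N)))// FM.
  rewrite -(real_normK (num_real (\sum_(j < m) F j))).
  rewrite -[X in _ * X](sqr_sqrtr M0) -exprMn ler_pXn2r ?nnegrE ?mulr_ge0 ?sqrtr_ge0//.
  apply: (le_trans (ler_norm_sum _ _ _)).
  apply: (@le_trans _ _ (\sum_(j < m) Num.sqrt M)).
    by apply: ler_sum => j _; rewrite -sqrtr_sqr ler_wsqrtr// FM.
  by rewrite big_const card_ord iter_addr addr0 mulr_natl.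
apply: (le_trans (cs d (fun j => 'C(2 * d, j)%:R * iter j fwd_diff u 0%N) (64 ^+ d * S) _)).
  move=> j jd; rewrite exprMn.
  have C2 : 'C(2 * d, j)%:R ^+ 2 <= 16 ^+ d :> R.
    rewrite (_ : 16 ^+ d = ((2 ^ (2 * d))%N%:R : R) ^+ 2).
      by rewrite ler_pXn2r ?nnegrE// ler_nat leq_bin_exp2.
    rewrite natrX -exprM mulnAC exprM; congr (_ ^+ _).
    by rewrite -natrX.
  have D2 : iter j fwd_diff u 0%N ^+ 2 <= 4 ^+ d * S.
    apply: (le_trans (iter_fwd_diff_sqr _ _ _)); apply: ler_pM.
    - by rewrite exprn_ge0.
    - by apply: sumr_ge0 => l _; exact: sqr_ge0.
    - by rewrite ler_weXn2l ?ler1n// ltnW.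
    - rewrite /S -!(big_mkord xpredT (fun j => u j ^+ 2)).
      rewrite [leRHS](@big_cat_nat _ _ _ j.+1)//= lerDl.
      by apply: sumr_ge0 => l _; exact: sqr_ge0.
  have -> : 64 ^+ d * S = 16 ^+ d * (4 ^+ d * S).
    by rewrite mulrA -exprMn -natrM.
  by apply: ler_pM; rewrite ?sqr_ge0.
rewrite mulrA ler_wpM2r// (_ : 256 = 4 * 64 :> R); last by rewrite -natrM.
rewrite exprMn ler_wpM2r ?exprn_ge0//.
rewrite (_ : 4 = 2 ^+ 2 :> R) -?exprM 1?mulnC ?exprM; last by rewrite expr2 -natrM.
rewrite ler_pXn2r ?nnegrE ?exprn_ge0// -natrX ler_nat.
exact: ltnW (ltn_expl _ _).
Qed.

(** Leibniz rule for an affine factor, whose differences of order two vanish. *)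
Lemma iter_fwd_diff_linM (a b : R) u m i :
  iter m.+1 fwd_diff (fun i => (a + b * i%:R) * u i) i =
  (a + b * i%:R) * iter m.+1 fwd_diff u i + m.+1%:R * b * iter m fwd_diff u i.+1.
Proof.
elim: m i => [|m IHm] i.
  by rewrite /= /fwd_diff -natr1; ring.
rewrite iterS {1}/fwd_diff !IHm; pose v := iter m fwd_diff u.
have E l : iter m.+1 fwd_diff u l = v l.+1 - v l by [].
have E2 l : iter m.+2 fwd_diff u l = v l.+2 - v l.+1 - (v l.+1 - v l) by [].
rewrite E2 !E -/v -!natr1; ring.
Qed.

Lemma iter_fwd_diff_pol n d (f : 'rV[R]_n -> R) (a b : R) x : pol d f ->
  forall i, iter d fwd_diff (fun i => f ((a + b * i%:R) *: x)) i = 0.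
Proof.
have diff0 m l : iter m fwd_diff (fun _ => 0 : R) l = 0.
  by elim: m l => // m IHm l; rewrite iterS /fwd_diff !IHm subrr.
elim=> {d f} [d|d c|d f g _ IHf _ IHg|d i f _ IHf] l.
- exact: diff0.
- rewrite iterSr (_ : fwd_diff _ = fun _ => 0); first exact: diff0.
  by apply/funext => j; rewrite /fwd_diff subrr.
- have diffD m (u v : nat -> R) j : iter m fwd_diff (fun i => u i + v i) j =
      iter m fwd_diff u j + iter m fwd_diff v j.
    elim: m j => // m IHm j; rewrite !iterS /fwd_diff -/fwd_diff !IHm.
    by rewrite opprD addrACA.
  by rewrite diffD IHf IHg addr0.
- rewrite (_ : (fun j => _) = fun j : nat => (a * x ord0 i + (b * x ord0 i) * j%:R) *
      f ((a + b * j%:R) *: x)).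
    rewrite (iter_fwd_diff_linM _ _ (fun j => f ((a + b * j%:R) *: x))).
    by rewrite iterS /fwd_diff -/fwd_diff !IHf subr0 !mulr0 addr0.
  by apply/funext => j; rewrite mxE mulrDl mulrAC.
Qed.

End newton_differences.

Section tail_bound.
Context {R : realType} {n : nat}.
Variables (roots : {fset 'rV[R]_n}) (k : 'rV[R]_n -> R).
Hypothesis roots_sys : root_system roots.
Hypothesis k_ge0 : forall a, a \in roots -> 0 <= k a.
Local Notation mu := (dunkl_nmeasure roots k).
Local Notation D := (@dunkl_dim R n roots k).

Lemma dunkl_gamma_ge0 : 0 <= dunkl_gamma roots k.
Proof.
rewrite mulr_ge0// big_seq; apply: sumr_ge0 => a aR; exact: k_ge0.
Qed.

Lemma dunkl_dim_ge0 : 0 <= D.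
Proof. by rewrite addr_ge0// mulr_ge0// dunkl_gamma_ge0. Qed.

Lemma dot_scale (s : R) (x : 'rV[R]_n) : dot (s *: x) (s *: x) = s ^+ 2 * dot x x.
Proof. by rewrite dotZl dotZr mulrA expr2. Qed.

Lemma measurable_sqr_expR d (f : 'rV[R]_n -> R) (e : R) : pol d f ->
  measurable_fun setT (fun x => (f x ^+ 2 * expR (e * dot x x))%:E).
Proof.
move=> /measurable_pol mf; apply: measurableT_comp => //.
apply: measurable_funM; first exact: measurable_funX.
exact: measurable_expR_dot.
Qed.

Lemma sqr_expR_ge0 (f : 'rV[R]_n -> R) (e : R) x :
  (0 <= (f x ^+ 2 * expR (e * dot x x))%:E)%E.
Proof. by rewrite lee_fin mulr_ge0 ?sqr_ge0 ?expR_ge0. Qed.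

(* Dilating by s <= 1 only enlarges the Gaussian factor. *)
Lemma dilation_bound d (f : 'rV[R]_n -> R) (s : R) : pol d f -> 2^-1 <= s <= 1 ->
  (\int[mu]_x (f (s *: x) ^+ 2 * expR (- 1 * dot x x))%:E <=
   (2 `^ D)%:E * \int[mu]_x (f x ^+ 2 * expR (- 1 * dot x x))%:E)%E.
Proof.
move=> pf /andP[s2 s1].
have s0 : 0 < s by rewrite (lt_le_trans _ s2).
pose F x := (f x ^+ 2 * expR (- 1 * dot x x))%:E.
have mF : measurable_fun setT F by exact: measurable_sqr_expR pf.
have F0 x : (0 <= F x)%E by exact: sqr_expR_ge0.
apply: (@le_trans _ _ (\int[mu]_x F (s *: x))%E).
  apply: ge0_le_integral => //=.
  - by move=> x _; rewrite lee_fin mulr_ge0 ?sqr_ge0 ?expR_ge0.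
  - apply: measurableT_comp => //; apply: measurable_funM.
      apply: measurable_funX; apply: measurableT_comp; first exact: measurable_pol pf.
      exact: measurable_rV_scale.
    exact: measurable_expR_dot.
  - by apply: measurableT_comp => //; exact: measurable_rV_scale.
  move=> x _; rewrite lee_fin ler_wpM2l ?sqr_ge0// ler_expR dot_scale.
  rewrite !mulN1r lerN2 ler_piMl ?dot_ge0//.
  by rewrite expr_le1// ltW.
rewrite integral_dunkl_scale//; apply: lee_wpmul2r; first exact: integral_ge0.
have s0' := ltW s0.
rewrite lee_fin powRN -[leLHS]mul1r ler_pdivrMr ?powR_gt0// -powRM//.
rewrite [leLHS](_ : 1 = 1 `^ D); last by rewrite powR1.
rewrite ge0_ler_powR ?nnegrE ?dunkl_dim_ge0 ?mulr_ge0//.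
by rewrite mulrC -ler_pdivrMr// mul1r.
Qed.

(* On each ray, the value at 3/2 is extrapolated from the d nodes
   1/2 + j / (2 d) in [1/2, 1[. *)
Lemma dilated_mass_bound d (f : 'rV[R]_n -> R) : pol d f ->
  (\int[mu]_x (f x ^+ 2 * expR (- (4 / 9) * dot x x))%:E <=
   (3 `^ D * 4 ^+ (5 * d))%:E * \int[mu]_x (f x ^+ 2 * expR (- 1 * dot x x))%:E)%E.
Proof.
move=> pf.
set I := (\int[mu]_x (f x ^+ 2 * expR (- 1 * dot x x))%:E)%E.
have I0 : (0 <= I)%E by apply: integral_ge0 => x _; exact: sqr_expR_ge0.
pose F x := (f x ^+ 2 * expR (- (4 / 9) * dot x x))%:E.
have mF : measurable_fun setT F by exact: measurable_sqr_expR pf.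
have F0 x : (0 <= F x)%E by exact: sqr_expR_ge0.
have s0 : 0 < 3 / 2 :> R by rewrite divr_gt0.
have E := integral_dunkl_scale roots k s0 mF F0.
have -> : (\int[mu]_x (f x ^+ 2 * expR (- (4 / 9) * dot x x))%:E =
    ((3 / 2) `^ D)%:E * \int[mu]_x F ((3 / 2) *: x))%E.
  by rewrite E muleA -EFinM powRN divff ?mul1e// gt_eqF// powR_gt0.
pose s (j : nat) : R := 2^-1 + (2 * d%:R)^-1 * j%:R.
have ptw x : (F ((3 / 2) *: x) <=
    (4 ^+ (4 * d))%:E * \sum_(j < d) (f (s j *: x) ^+ 2 * expR (- 1 * dot x x))%:E)%E.
  rewrite sumEFin -EFinM lee_fin dot_scale -mulr_suml mulrA.
  (* The rate 4 / 9 is chosen so that the dilation by 3 / 2 turns it into 1, the rate of the squared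
     Gaussian. *)
  rewrite (_ : - (4 / 9) * ((3 / 2) ^+ 2 * dot x x) = - 1 * dot x x); last first.
    by field.
  rewrite ler_wpM2r ?expR_ge0//.
  have [d0|d0] := posnP d.
    rewrite (pol0_eq0 _ (_ : pol 0 f)) -?d0// expr0n/= mulr_ge0 ?exprn_ge0//.
    by apply: sumr_ge0 => *; exact: sqr_ge0.
  have := newton_extrapolation (@iter_fwd_diff_pol _ _ _ _ 2^-1 (2 * d%:R)^-1 x pf).
  rewrite (_ : 2^-1 + _ = 3 / 2)//.
  rewrite natrM mulVf ?mulf_neq0 ?pnatr_eq0 -?lt0n//.
  by field.
have s01 j : (j < d)%N -> 2^-1 <= s j <= 1.
  move=> jd; have d0 : 0 < d%:R :> R by rewrite ltr0n (leq_ltn_trans _ jd).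
  rewrite lerDl mulr_ge0 ?invr_ge0 ?mulr_ge0//=.
  rewrite -lerBrDl ler_pdivrMl ?mulr_gt0//.
  rewrite (_ : 2 * d%:R * _ = d%:R); last by field.
  by rewrite ler_nat ltnW.
have mfs (j : 'I_d) : measurable_fun setT
    (fun x : 'rV[R]_n => (f (s j *: x) ^+ 2 * expR (- 1 * dot x x))%:E).
  apply: measurableT_comp => //; apply: measurable_funM; last exact: measurable_expR_dot.
  apply: measurable_funX; apply: measurableT_comp; first exact: measurable_pol pf.
  exact: measurable_rV_scale.
have fs0 (j : 'I_d) x : (0 <= (f (s j *: x) ^+ 2 * expR (- 1 * dot x x))%:E)%E.
  by rewrite lee_fin mulr_ge0 ?sqr_ge0 ?expR_ge0.
have J : (\int[mu]_x F ((3 / 2) *: x) <= (2 `^ D * 4 ^+ (5 * d))%:E * I)%E.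
  apply: le_trans (_ : \int[mu]_x ((4 ^+ (4 * d))%:E *
      \sum_(j < d) (f (s j *: x) ^+ 2 * expR (- 1 * dot x x))%:E) <= _)%E.
    apply: ge0_le_integral => //=.
    - by apply: measurableT_comp => //; exact: measurable_rV_scale.
    - by apply: emeasurable_funM => //; exact: emeasurable_sum.
  have c0 : (0 <= (4 ^+ (4 * d))%:E :> \bar R)%E by rewrite lee_fin exprn_ge0.
  have mS := @emeasurable_sum _ _ _ _ _ (index_enum 'I_d) _ mfs.
  have S0 (x : 'rV[R]_n) : setT x ->
      (0 <= \sum_(j < d) (f (s j *: x) ^+ 2 * expR (- 1 * dot x x))%:E)%E.
    by move=> _; apply: sume_ge0 => j _; exact: fs0.
  rewrite (ge0_integralZl mu measurableT mS S0 c0) ge0_integral_sum//.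
  apply: le_trans (_ : (4 ^+ (4 * d))%:E * \sum_(j < d) ((2 `^ D)%:E * I) <= _)%E.
    apply: lee_wpmul2l; first by rewrite lee_fin exprn_ge0.
    apply: lee_sum => j _; exact: (dilation_bound pf (s01 _ (ltn_ord j))).
  rewrite -ge0_sume_distrl; last by move=> j _; rewrite lee_fin powR_ge0.
  rewrite sumEFin big_const card_ord iter_addr addr0 muleA -EFinM.
  apply: lee_wpmul2r => //; rewrite lee_fin -[_ `^ _ *+ d]mulr_natl mulrA [leRHS]mulrC.
  rewrite ler_wpM2r ?powR_ge0//.
  rewrite (_ : 5 * d = 4 * d + d)%N; last by rewrite -mulSnr.
  rewrite exprD; apply: ler_wpM2l; first exact: exprn_ge0.
  by rewrite -natrX ler_nat ltnW// ltn_expl.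
apply: le_trans (lee_wpmul2l _ J) _; first by rewrite lee_fin powR_ge0.
rewrite muleA -EFinM mulrA -powRM; [|exact: ltW|exact: ler0n].
have -> : 3 / 2 * 2 = 3 :> R by field.
exact: lexx.
Qed.

(* Beyond |x|^2 = tail_radius * d, the gain exp (- 5/9 |x|^2) beats the loss
   3 ^ D * 4 ^ (5 d) of the extrapolation, as 4 <= e^2 and 3 <= e^2. *)
Definition tail_radius : R := 9 / 5 * (12 + 2 * D).

Lemma tail_radius_gt0 : 0 < tail_radius.
Proof. by rewrite mulr_gt0 ?divr_gt0// ltr_wpDr// mulr_ge0// dunkl_dim_ge0. Qed.

Lemma measurable_dot_gt (K : R) : measurable [set x : 'rV[R]_n | K < dot x x].
Proof.
rewrite -[X in measurable X]setTI.
rewrite (_ : [set x | _] = (fun x : 'rV[R]_n => dot x x) @^-1` `]K, +oo[).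
  exact: measurable_dotxx.
by apply/seteqP; split=> x /=; rewrite in_itv/= andbT.
Qed.

Lemma pol_tail d (f : 'rV[R]_n -> R) : (0 < d)%N -> pol d f ->
  (\int[mu]_(x in [set x | (tail_radius * d%:R < dot x x)%R])
      (f x ^+ 2 * expR (- 1 * dot x x))%:E <=
   (4^-1)%:E * \int[mu]_x (f x ^+ 2 * expR (- 1 * dot x x))%:E)%E.
Proof.
move=> d0 pf; set K := _ * d%:R; set S := [set x | _].
set I := (\int[mu]_x (f x ^+ 2 * expR (- 1 * dot x x))%:E)%E.
have I0 : (0 <= I)%E by apply: integral_ge0 => x _; exact: sqr_expR_ge0.
have mS : measurable S by exact: measurable_dot_gt.
have mf e := @measurable_sqr_expR _ _ e pf.
have c0 : (0 <= (expR (- (5 / 9) * K))%:E :> \bar R)%E by rewrite lee_fin expR_ge0.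
have f0 e x (_ : setT x) := @sqr_expR_ge0 f e x.
apply: (@le_trans _ _ ((expR (- (5 / 9) * K))%:E *
    \int[mu]_x (f x ^+ 2 * expR (- (4 / 9) * dot x x))%:E)%E).
  rewrite -(ge0_integralZl mu measurableT (mf _) (f0 _) c0).
  pose F x := ((expR (- (5 / 9) * K))%:E *
    (f x ^+ 2 * expR (- (4 / 9) * dot x x))%:E)%E.
  have mF : measurable_fun setT F by apply: emeasurable_funM => //; exact: mf.
  have F0 x : setT x -> (0 <= F x)%E by move=> ?; rewrite mule_ge0// f0.
  apply: le_trans (_ : (\int[mu]_(x in S) F x <= _)%E); last first.
    exact: ge0_subset_integral.
  apply: ge0_le_integral => //.
  - by move=> x _; exact: f0.
  - by apply: measurable_funTS; exact: mf.
  - exact: measurable_funTS.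
  move=> x /= Kx; rewrite /F -EFinM lee_fin mulrCA ler_wpM2l ?sqr_ge0//.
  rewrite -expRD ler_expR; move: Kx; rewrite /S/= => Kx; lra.
apply: le_trans (lee_wpmul2l c0 (dilated_mass_bound pf)) _.
rewrite muleA -EFinM; apply: lee_wpmul2r => //; rewrite lee_fin.
have e1 : 2 <= expR 1 :> R by have := @expR_ge1Dx R 1; lra.
have e2 : 3 <= expR 2 :> R by have := @expR_ge1Dx R 2; lra.
have E4 : 4 <= expR 2 :> R.
  have -> : 4 = 2 ^+ 2 :> R by rewrite -natrX.
  by rewrite -[X in expR X]mulr1 expRM_natl ler_pXn2r ?nnegrE ?expR_ge0.
have E9 : 4 ^+ (5 * d) <= expR (10 * d%:R) :> R.
  have -> : 10 * d%:R = (5 * d)%:R * 2 :> R.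
    by rewrite natrM; ring.
  by rewrite expRM_natl ler_pXn2r ?nnegrE ?expR_ge0// muln_gt0.
have ED : 3 `^ D <= expR (2 * D).
  by rewrite expRM ge0_ler_powR ?nnegrE ?dunkl_dim_ge0 ?expR_ge0.
apply: (@le_trans _ _ (expR (- (5 / 9) * K) * (expR (2 * D) * expR (10 * d%:R)))).
  apply: ler_wpM2l; first exact: expR_ge0.
  by apply: ler_pM ED E9; [exact: powR_ge0|rewrite exprn_ge0].
(* The total exponent - (12 + 2 D) d + 2 D + 10 d is at most - 2 because d >= 1, and exp (- 2) <= 1
   / 4 by [E4]. *)
apply: (@le_trans _ _ (expR (- 2))); last first.
  by rewrite expRN lef_pV2 ?posrE ?expR_gt0.
rewrite -!expRD ler_expR /K /tail_radius.
have d1 : 1 <= d%:R :> R by rewrite ler1n.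
have D0 := dunkl_dim_ge0; move: D0; set D' := D => D0.
rewrite (_ : - (5 / 9) * _ = - (12 + 2 * D') * d%:R); last by field.
nra.
Qed.

Lemma pol_gauss_fin d (f : 'rV[R]_n -> R) : pol d f ->
  (\int[mu]_x (f x ^+ 2 * expR (- 1 * dot x x))%:E < +oo)%E.
Proof.
move=> pf; rewrite ge0_integral_mscale//; last 2 first.
- exact: measurable_sqr_expR pf.
- by move=> x _; exact: sqr_expR_ge0.
apply: lte_mul_pinfty => //.
have e0 : 0 < 4^-1 :> R by [].
have [C C0 fC] := pol_bound e0 pf.
have me : measurable_fun setT (fun x : 'rV[R]_n => (expR (- 2^-1 * dot x x))%:E).
  by apply: measurableT_comp => //; exact: measurable_expR_dot.
apply: (@le_lt_trans _ _ (\int[dunkl_measure roots k]_x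
    ((C ^+ 2)%:E * (expR (- 2^-1 * dot x x))%:E))%E).
  apply: ge0_le_integral => //.
  - by move=> x _; exact: sqr_expR_ge0.
  - exact: measurable_sqr_expR pf.
  - exact: emeasurable_funM.
  move=> x _; rewrite -EFinM lee_fin.
  have : f x ^+ 2 <= (C * expR (4^-1 * dot x x)) ^+ 2.
    rewrite -(real_normK (num_real (f x))) ler_pXn2r ?nnegrE// mulr_ge0 ?expR_ge0//.
  move=> /(ler_wpM2r (expR_ge0 (- 1 * dot x x))) /le_trans; apply.
  rewrite exprMn -mulrA -expRM_natl -expRD ler_wpM2l ?sqr_ge0// ler_expR.
  by lra.
have e1 (x : 'rV[R]_n) : setT x -> (0 <= (expR (- 2^-1 * dot x x))%:E)%E.
  by move=> _; rewrite lee_fin expR_ge0.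
have C2 : (0 <= (C ^+ 2)%:E :> \bar R)%E by rewrite lee_fin sqr_ge0.
rewrite (ge0_integralZl (dunkl_measure roots k) measurableT me e1 C2).
by apply: lte_mul_pinfty => //; exact: integral_gauss_nu.
Qed.

Lemma measurable_dot_le (K : R) : measurable [set x : 'rV[R]_n | dot x x <= K].
Proof.
rewrite (_ : [set x | _] = ~` [set x | K < dot x x]).
  by apply: measurableC; exact: measurable_dot_gt.
by apply/seteqP; split=> x /=; rewrite leNgt => /negP.
Qed.

Lemma unit_ball_fin : (mu [set x : 'rV[R]_n | (dot x x <= 1)%R] < +oo)%E.
Proof.
have E1 := pol_gauss_fin (pol_cst 0 (expR 1)); apply: le_lt_trans E1.
rewrite -[X in mu X]setIT -integral_indic//; last exact: measurable_dot_le.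
apply: ge0_le_integral => //=.
- by apply: measurableT_comp => //; apply: measurable_indic; exact: measurable_dot_le.
- exact: measurable_sqr_expR (pol_cst 0 (expR 1)).
move=> x _; rewrite lee_fin indicE; case: (boolP (_ \in _)) => [|_]; last first.
  by rewrite mulr_ge0 ?sqr_ge0 ?expR_ge0.
rewrite inE/= => x1; rewrite -expRM_natl -expRD -[leLHS]expR0 ler_expR.
by have := dot_ge0 x; lra.
Qed.

Lemma ball_measure (s : R) : 0 < s ->
  (mu [set x : 'rV[R]_n | (dot x x <= s ^+ 2)%R] =
   (s `^ D)%:E * mu [set x : 'rV[R]_n | (dot x x <= 1)%R])%E.
Proof.
move=> s0; pose B : set 'rV[R]_n := [set x | dot x x <= 1].
have mB : measurable B by exact: measurable_dot_le.
have mI : measurable_fun setT (fun x => (\1_B x)%:E : \bar R).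
  by apply: measurableT_comp => //; exact: measurable_indic.
have I0 x : (0 <= (\1_B x)%:E :> \bar R)%E by rewrite lee_fin.
have s'0 : 0 < s^-1 by rewrite invr_gt0.
have := integral_dunkl_scale roots k s'0 mI I0.
rewrite [X in _ = (_ * X)%E -> _]integral_indic// setIT.
have -> : s^-1 `^ (- D) = s `^ D.
  by rewrite -powR_inv1 ?ltW// -powRrM mulN1r opprK.
move=> <-; rewrite -[X in mu X]setIT -integral_indic//; last exact: measurable_dot_le.
apply: eq_integral => x _; rewrite !indicE; congr (_%:R%:E); congr nat_of_bool.
apply/idP/idP; rewrite !inE /B/= dot_scale exprVn.
  by rewrite mulrC ler_pdivrMr ?exprn_gt0// mul1r.
by rewrite mulrC ler_pdivrMr ?exprn_gt0// mul1r.
Qed.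

End tail_bound.

(** * The unitary group on polynomials times a Gaussian *)

Section L2_norm.
Context {R : realType} {n : nat}.
Variables (roots : {fset 'rV[R]_n}) (k : 'rV[R]_n -> R).
Local Notation mu := (dunkl_nmeasure roots k).
Local Notation L2 := (in_L2 roots k).
Local Notation L2norm := (L2norm roots k).
Local Notation inner := (L2inner roots k).
Implicit Types f g : 'rV[R]_n -> R[i].

Definition cmeasurable f : Prop :=
  measurable_fun setT (fun x => complex.Re (f x)) /\
  measurable_fun setT (fun x => complex.Im (f x)).

(** As [fine] sends +oo to 0, an upper bound on this real number is informative only together with
    membership in L^2. *)
Definition norm2 f : R := fine (L2norm f).

Lemma normc_sqr (z : R[i]) :
  Normc.normc z ^+ 2 = complex.Re z ^+ 2 + complex.Im z ^+ 2.
Proof. by case: z => a b /=; rewrite sqr_sqrtr// addr_ge0 ?sqr_ge0. Qed.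

Lemma normc_ge0 (z : R[i]) : 0 <= Normc.normc z.
Proof. by case: z => a b /=; rewrite sqrtr_ge0. Qed.

Lemma normcR (a : R) : Normc.normc (a%:C)%C = `|a|.
Proof. by rewrite /= expr0n/= addr0 sqrtr_sqr. Qed.

Lemma L2_cmeasurable f : L2 f -> cmeasurable f.
Proof. by case. Qed.

Lemma cmeasurable_normc f : cmeasurable f ->
  measurable_fun setT (fun x => Normc.normc (f x)).
Proof.
move=> [mR mI].
rewrite (_ : (fun x => _) =
    fun x => (complex.Re (f x) ^+ 2 + complex.Im (f x) ^+ 2) `^ 2^-1).
  apply: (measurableT_comp (measurable_powR _)).
  by apply: measurable_funD; exact: measurable_funX.
apply/funext => x; rewrite powR12_sqrt ?addr_ge0 ?sqr_ge0//.
by case: (f x).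
Qed.

Lemma cmeasurableD f g : cmeasurable f -> cmeasurable g ->
  cmeasurable (fun x => f x + g x).
Proof.
move=> [mR mI] [mR' mI']; split.
  rewrite (_ : (fun x => _) = fun x => complex.Re (f x) + complex.Re (g x)).
    exact: measurable_funD.
  by apply/funext => x; case: (f x) (g x) => [? ?] [].
rewrite (_ : (fun x => _) = fun x => complex.Im (f x) + complex.Im (g x)).
  exact: measurable_funD.
by apply/funext => x; case: (f x) (g x) => [? ?] [].
Qed.

Lemma cmeasurableM f g : cmeasurable f -> cmeasurable g ->
  cmeasurable (fun x => f x * g x).
Proof.
move=> [mR mI] [mR' mI']; split.
  rewrite (_ : (fun x => _) = fun x => complex.Re (f x) * complex.Re (g x) -
      complex.Im (f x) * complex.Im (g x)).
    by apply: measurable_funB; exact: measurable_funM.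
  by apply/funext => x; case: (f x) (g x) => [? ?] [].
rewrite (_ : (fun x => _) = fun x => complex.Re (f x) * complex.Im (g x) +
    complex.Im (f x) * complex.Re (g x)).
  by apply: measurable_funD; exact: measurable_funM.
by apply/funext => x; case: (f x) (g x) => [? ?] [].
Qed.

Lemma cmeasurable_cst (c : R[i]) : cmeasurable (fun _ => c).
Proof. by split. Qed.

Lemma cmeasurable_real (f : 'rV[R]_n -> R) : measurable_fun setT f ->
  cmeasurable (fun x => (f x)%:C%C).
Proof. by move=> mf; split => //=. Qed.

Lemma L2normE f : L2norm f = ((\int[mu]_x (Normc.normc (f x) ^+ 2)%:E) `^ 2^-1)%E.
Proof.
rewrite /Defs.L2norm unlock; congr (_ `^ _)%E; apply: eq_integral => x _.
by rewrite abse_EFin poweR_EFin powR_mulrn// ger0_norm// normc_ge0.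
Qed.

Lemma L2norm_ge0 f : (0 <= L2norm f)%E.
Proof. exact: Lnorm_ge0. Qed.

Lemma L2norm_sqr f : (\int[mu]_x (Normc.normc (f x) ^+ 2)%:E = L2norm f * L2norm f)%E.
Proof.
have I0 : (0 <= \int[mu]_x (Normc.normc (f x) ^+ 2)%:E)%E.
  by apply: integral_ge0 => x _; rewrite lee_fin sqr_ge0.
rewrite L2normE; have [->|I1] := eqVneq (\int[mu]_x (Normc.normc (f x) ^+ 2)%:E)%E 0%E.
  by rewrite poweR0r ?mul0e// invr_neq0.
rewrite -poweRD; last by rewrite nneg_neq0_poweRD_def.
by rewrite (_ : 2^-1 + 2^-1 = 1) ?poweRe1//; field.
Qed.

Lemma norm2_ge0 f : 0 <= norm2 f.
Proof. by rewrite fine_ge0// L2norm_ge0. Qed.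

Lemma L2_fin f : L2 f -> L2norm f = (norm2 f)%:E.
Proof. by case=> _ _ foo; rewrite fineK// ge0_fin_numE// L2norm_ge0. Qed.

Lemma integral_normc2 f : L2 f ->
  (\int[mu]_x (Normc.normc (f x) ^+ 2)%:E = (norm2 f ^+ 2)%:E)%E.
Proof. by move=> /L2_fin E; rewrite L2norm_sqr E -EFinM expr2. Qed.

Lemma in_L2P f : cmeasurable f -> (L2norm f < +oo)%E -> L2 f.
Proof. by case=> mR mI foo; split. Qed.

Lemma L2norm_le f g : cmeasurable f -> cmeasurable g ->
  (forall x, Normc.normc (f x) <= Normc.normc (g x)) -> (L2norm f <= L2norm g)%E.
Proof.
move=> mf mg fg; rewrite !L2normE; apply: gt0_ler_poweR => //.
- by rewrite in_itv/= leey andbT integral_ge0// => x _; rewrite lee_fin sqr_ge0.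
- by rewrite in_itv/= leey andbT integral_ge0// => x _; rewrite lee_fin sqr_ge0.
apply: ge0_le_integral => //.
- by move=> x _; rewrite lee_fin sqr_ge0.
- by apply: measurableT_comp => //; apply: measurable_funX; exact: cmeasurable_normc.
- by apply: measurableT_comp => //; apply: measurable_funX; exact: cmeasurable_normc.
by move=> x _; rewrite lee_fin ler_pXn2r ?nnegrE ?normc_ge0.
Qed.

Lemma L2normD f g : cmeasurable f -> cmeasurable g ->
  (L2norm (fun x => (f x + g x)%R) <= L2norm f + L2norm g)%E.
Proof.
move=> mf mg.
have := minkowski_EFin mu (cmeasurable_normc mf) (cmeasurable_normc mg) (ler1n _ 2).
apply: le_trans.
rewrite L2normE unlock; apply: gt0_ler_poweR => //.
- by rewrite in_itv/= leey andbT integral_ge0// => x _; rewrite lee_fin sqr_ge0.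
- by rewrite in_itv/= leey andbT integral_ge0// => x _; rewrite poweR_ge0.
rewrite [leRHS](_ : _ = \int[mu]_x ((Normc.normc (f x) + Normc.normc (g x)) ^+ 2)%:E)%E.
  apply: ge0_le_integral => //.
  - by move=> x _; rewrite lee_fin sqr_ge0.
  - apply: measurableT_comp => //; apply: measurable_funX.
    by apply: cmeasurable_normc; exact: cmeasurableD.
  - apply: measurableT_comp => //; apply: measurable_funX.
    by apply: measurable_funD; exact: cmeasurable_normc.
  move=> x _; rewrite lee_fin ler_pXn2r ?nnegrE ?addr_ge0 ?normc_ge0//.
  exact: le_normcD.
apply: eq_integral => x _.
transitivity ((`|Normc.normc (f x) + Normc.normc (g x)|%R `^ 2)%:E); first by [].
by rewrite powR_mulrn// ger0_norm// addr_ge0// normc_ge0.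
Qed.

Lemma L2normZ (c : R[i]) f : cmeasurable f ->
  (L2norm (fun x => (c * f x)%R) = (Normc.normc c)%:E * L2norm f)%E.
Proof.
move=> mf; rewrite !L2normE.
under eq_integral do rewrite Normc.normcM exprMn EFinM.
have mf2 : measurable_fun setT (fun x => (Normc.normc (f x) ^+ 2)%:E).
  by apply: measurableT_comp => //; apply: measurable_funX; exact: cmeasurable_normc.
have f0 (x : 'rV[R]_n) : setT x -> (0 <= (Normc.normc (f x) ^+ 2)%:E)%E.
  by move=> _; rewrite lee_fin sqr_ge0.
have c0 : (0 <= (Normc.normc c ^+ 2)%:E)%E by rewrite lee_fin sqr_ge0.
rewrite (ge0_integralZl mu measurableT mf2 f0 c0).
rewrite poweRM ?lee_fin ?sqr_ge0//; last first.
  by apply: integral_ge0 => x _; rewrite lee_fin sqr_ge0.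
rewrite poweR_EFin -powR_mulrn ?normc_ge0// -powRrM divff ?pnatr_eq0// powRr1 ?normc_ge0//.
Qed.

Lemma L2norm_ae f g : cmeasurable f -> cmeasurable g ->
  f = g %[ae mu] -> L2norm f = L2norm g.
Proof.
move=> mf mg fg; rewrite !L2normE; congr (_ `^ _)%E.
apply: ge0_ae_eq_integral => //.
- by apply: measurableT_comp => //; apply: measurable_funX; exact: cmeasurable_normc.
- by apply: measurableT_comp => //; apply: measurable_funX; exact: cmeasurable_normc.
- by move=> x _; rewrite lee_fin sqr_ge0.
- by move=> x _; rewrite lee_fin sqr_ge0.
by move: fg; apply: filterS => x /(_ I) fgx _; rewrite fgx.
Qed.

Lemma L2D f g : L2 f -> L2 g -> L2 (fun x => f x + g x).
Proof.
move=> Lf Lg; have mf := L2_cmeasurable Lf; have mg := L2_cmeasurable Lg.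
apply: in_L2P; first exact: cmeasurableD.
by apply: le_lt_trans (L2normD mf mg) _; rewrite (L2_fin Lf) (L2_fin Lg) ltry.
Qed.

Lemma L2Z (c : R[i]) f : L2 f -> L2 (fun x => c * f x).
Proof.
move=> Lf; have mf := L2_cmeasurable Lf.
apply: in_L2P; first by apply: cmeasurableM => //; exact: cmeasurable_cst.
by rewrite L2normZ// (L2_fin Lf) -EFinM ltry.
Qed.

Lemma L2_zero : L2 (fun _ => 0).
Proof.
apply: in_L2P; first exact: cmeasurable_cst.
rewrite L2normE; under eq_integral do rewrite Normc.normc0 expr0n/=.
by rewrite integral0 poweR0r ?ltry// invr_neq0.
Qed.

Lemma L2_sum (I : Type) (r : seq I) (c : I -> R[i]) (F : I -> 'rV[R]_n -> R[i]) :
  (forall i, L2 (F i)) -> L2 (fun x => \sum_(i <- r) c i * F i x).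
Proof.
move=> LF; elim: r => [|i r IHr].
  by under eq_fun do rewrite big_nil; exact: L2_zero.
by under eq_fun do rewrite big_cons; apply: L2D => //; exact: L2Z.
Qed.

Lemma norm2D f g : L2 f -> L2 g -> norm2 (fun x => f x + g x) <= norm2 f + norm2 g.
Proof.
move=> Lf Lg; rewrite -lee_fin EFinD -(L2_fin Lf) -(L2_fin Lg) -(L2_fin (L2D Lf Lg)).
by apply: L2normD; exact: L2_cmeasurable.
Qed.

Lemma norm2Z (c : R[i]) f : L2 f -> norm2 (fun x => c * f x) = Normc.normc c * norm2 f.
Proof.
move=> Lf; rewrite /norm2 L2normZ; last exact: L2_cmeasurable.
by rewrite (L2_fin Lf) -EFinM.
Qed.

Lemma L2B f g : L2 f -> L2 g -> L2 (fun x => f x - g x).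
Proof.
by move=> Lf /(L2Z (- 1)) Lg; have := L2D Lf Lg; under eq_fun do rewrite mulN1r.
Qed.

Lemma norm2_ae f g : L2 f -> L2 g -> f = g %[ae mu] -> norm2 f = norm2 g.
Proof.
by move=> Lf Lg fg; rewrite /norm2 (L2norm_ae (L2_cmeasurable Lf) (L2_cmeasurable Lg) fg).
Qed.

Lemma inner_norm2 f : L2 f -> complex.Re (inner f f) = norm2 f ^+ 2.
Proof.
move=> Lf; rewrite /Defs.L2inner /= /Rintegral.
under eq_integral => x _.
  rewrite (_ : complex.Re _ = Normc.normc (f x) ^+ 2); last first.
    rewrite normc_sqr; case: (f x) => a b /=; ring.
  over.
by rewrite (integral_normc2 Lf).
Qed.

End L2_norm.

Section polynomial_span.
Context {R : realType} {n : nat}.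
Variables (roots : {fset 'rV[R]_n}) (k : 'rV[R]_n -> R).
Hypothesis roots_sys : root_system roots.
Hypothesis k_ge0 : forall a, a \in roots -> 0 <= k a.
Local Notation mu := (dunkl_nmeasure roots k).
Local Notation L2 := (in_L2 roots k).
Local Notation norm2 := (norm2 roots k).

(** A family with repetitions is enough: Euler's method needs finitely many generators, not a basis.
    Degree d.+1 is reached from the constant 1 and all products x_i e_j. *)
Lemma pol_generators d : exists (I : finType) (e : I -> 'rV[R]_n -> R),
  (forall i, pol d (e i)) /\
  (forall f, pol d f -> exists c : I -> R, forall x, f x = \sum_i c i * e i x).
Proof.
elim: d => [|d [J [e [pe He]]]].
  exists 'I_0, (fun _ _ => 0); split=> [i|f pf]; first exact: pol_zero.
  by exists (fun _ => 0) => x; rewrite big_ord0 (pol0_eq0 _ pf).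
exists (unit + 'I_n * J)%type, (fun o (x : 'rV[R]_n) =>
  if o is inr ij then x ord0 ij.1 * e ij.2 x else 1); split=> [[?|[i j]]|f].
- exact: pol_cst.
- exact: polX.
move Ed : d.+1 => d' pf.
elim: pf Ed => {d' f} [d'|d' c|d' f g _ IHf _ IHg|d' i f pf _] Ed.
- by exists (fun _ => 0) => x; rewrite big1// => i _; rewrite mul0r.
- exists (fun o => if o is inl _ then c else 0) => x.
  rewrite big_sumType/= big_const card_unit iter_addr addr0 mulr1 big1 ?addr0// => ? _.
  by rewrite mul0r.
- have [c Ec] := IHf Ed; have [c' Ec'] := IHg Ed.
  exists (fun o => c o + c' o) => x; rewrite Ec Ec' -big_split/=.
  by apply: eq_bigr => o _; rewrite mulrDl.
- case: Ed => Ed; rewrite -Ed in pf; have [c Ec] := He _ pf.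
  exists (fun o => if o is inr ij then (ij.1 == i)%:R * c ij.2 else 0) => x.
  rewrite Ec big_sumType/= [X in _ = X + _]big1 ?add0r => [|? _]; last by rewrite mul0r.
  rewrite -(pair_bigA _ (fun i' j => (i' == i)%:R * c j * (x ord0 i' * e j x)))/=.
  rewrite (bigD1 i)//= [X in _ = _ + X]big1 ?addr0 => [|i' /negPf ii']; last first.
    by apply: big1 => j _; rewrite ii' !mul0r.
  rewrite mulr_sumr; apply: eq_bigr => j _.
  by rewrite eqxx mul1r mulrCA.
Qed.

Definition cgauss (f : 'rV[R]_n -> R) : 'rV[R]_n -> R[i] :=
  fun x => (f x * gauss x)%:C%C.

Lemma gauss_sqr (x : 'rV[R]_n) : gauss x ^+ 2 = expR (- 1 * dot x x).
Proof. by rewrite -expRM_natl; congr expR; field. Qed.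

Lemma cgauss_sqr f x :
  Normc.normc (cgauss f x) ^+ 2 = f x ^+ 2 * expR (- 1 * dot x x).
Proof. by rewrite normcR real_normK ?num_real// exprMn gauss_sqr. Qed.

Lemma cgauss_cmeasurable d f : pol d f -> cmeasurable (cgauss f).
Proof.
move=> pf; apply: cmeasurable_real; apply: measurable_funM.
  exact: measurable_pol pf.
exact: measurable_gauss.
Qed.

Lemma cgauss_L2 d f : pol d f -> L2 (cgauss f).
Proof.
move=> pf; apply: in_L2P; first exact: cgauss_cmeasurable pf.
rewrite L2normE; apply: poweR_lty.
under eq_integral do rewrite cgauss_sqr.
exact: pol_gauss_fin pf.
Qed.

End polynomial_span.

Section dynamics.
Context {R : realType} {n : nat}.
Variables (roots : {fset 'rV[R]_n}) (k : 'rV[R]_n -> R) (b : 'rV[R]_n).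
Hypothesis roots_sys : root_system roots.
Hypothesis k_ge0 : forall a, a \in roots -> 0 <= k a.
Variable U : R -> ('rV[R]_n -> R[i]) -> ('rV[R]_n -> R[i]).
Hypothesis U_group : dunkl_hermite_group roots k b U.
Local Notation mu := (dunkl_nmeasure roots k).
Local Notation L2 := (in_L2 roots k).
Local Notation norm2 := (norm2 roots k).

Let UL2 t f : L2 f -> L2 (U t f).
Proof. exact: group_L2 U_group _ _. Qed.

Lemma norm2_group t f : L2 f -> norm2 (U t f) = norm2 f.
Proof.
move=> Lf; have := group_isometry U_group t Lf Lf.
move=> /(congr1 (@complex.Re R)).
rewrite !inner_norm2//; last exact: UL2.
by move=> /eqP; rewrite eqrXn2 ?norm2_ge0// => /eqP.
Qed.

Lemma group_add t f g : L2 f -> L2 g ->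
  U t (fun x => f x + g x) = (fun x => U t f x + U t g x) %[ae mu].
Proof.
move=> Lf Lg; have := group_linear U_group t 1 Lf Lg.
rewrite (_ : (fun x => 1 * f x + g x) = fun x => f x + g x); last first.
  by apply/funext => x; rewrite mul1r.
by apply: filterS => x + _ => /(_ I) ->; rewrite mul1r.
Qed.

Lemma group_scale t (c : R[i]) f : L2 f ->
  U t (fun x => c * f x) = (fun x => c * U t f x) %[ae mu].
Proof.
move=> Lf; have L0 := L2_zero roots k.
have U0 : U t (fun _ => 0) = (fun _ => 0) %[ae mu].
  (* Linearity with c = - 1 at zero functions reads U 0 = - U 0 + U 0. *)
  have := group_linear U_group t (- 1) L0 L0.
  rewrite (_ : (fun x => -1 * 0 + 0) = fun _ : 'rV[R]_n => 0); last first.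
    by apply/funext => x; rewrite mulr0 addr0.
  by apply: filterS => x + _ => /(_ I) ->; rewrite mulN1r addNr.
have := group_linear U_group t c Lf L0.
rewrite (_ : (fun x => c * f x + 0) = fun x => c * f x); last first.
  by apply/funext => x; rewrite addr0.
move=> H; move: U0 H; apply: filterS2 => x /(_ I) U0 /(_ I) H _.
by rewrite H U0 addr0.
Qed.

Lemma group_sum t (I : Type) (r : seq I) (c : I -> R[i]) (F : I -> 'rV[R]_n -> R[i]) :
  (forall i, L2 (F i)) ->
  U t (fun x => \sum_(i <- r) c i * F i x) =
  (fun x => \sum_(i <- r) c i * U t (F i) x) %[ae mu].
Proof.
move=> LF; elim: r => [|i r IHr].
  have := group_scale t 0 (L2_zero roots k).
  rewrite (_ : (fun _ => 0 * 0) = fun x => \sum_(i <- [::]) c i * F i x); last first.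
    by apply/funext => x; rewrite big_nil mulr0.
  by apply: filterS => x + _ => /(_ Logic.I) ->; rewrite big_nil mul0r.
have := group_linear U_group t (c i) (LF i) (L2_sum r c LF).
rewrite (_ : (fun x => c i * F i x + _) = fun x => \sum_(i <- i :: r) c i * F i x); last first.
  by apply/funext => x; rewrite big_cons.
move=> H; move: IHr H; apply: filterS2 => x /(_ Logic.I) H1 /(_ Logic.I) H2 _.
by rewrite H2 H1 big_cons.
Qed.

Section span.
Variables (I : finType) (G : I -> 'rV[R]_n -> R[i]).
Hypothesis LG : forall i, L2 (G i).

(** Approximation replaces membership in the span: the tail bound compares norms and tolerates a
    small error, so no closedness of the span has to be proved. *)
Definition near_span (eps : R) (h : 'rV[R]_n -> R[i]) : Prop :=
  exists c : I -> R[i], norm2 (fun x => h x - \sum_i c i * G i x) <= eps.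

Lemma near_span_ae eps h h' : L2 h -> L2 h' -> h = h' %[ae mu] ->
  near_span eps h' -> near_span eps h.
Proof.
move=> Lh Lh' hh' [c Hc]; exists c; apply: le_trans Hc.
rewrite le_eqVlt; apply/orP; left; apply/eqP; apply: norm2_ae.
- by apply: L2B => //; exact: L2_sum.
- by apply: L2B => //; exact: L2_sum.
by move: hh'; apply: filterS => x /(_ Logic.I) E _; rewrite E.
Qed.

Lemma near_spanD eps eta h g : L2 h -> L2 g -> near_span eps h -> norm2 g <= eta ->
  near_span (eps + eta) (fun x => h x + g x).
Proof.
move=> Lh Lg [c Hc] geta; exists c.
rewrite (_ : (fun x => _) = fun x => (h x - \sum_i c i * G i x) + g x).
  apply: le_trans (norm2D (L2B Lh (L2_sum _ _ LG)) Lg) _.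
  exact: lerD.
by apply/funext => x; rewrite addrAC.
Qed.

Lemma norm2_sum (J : finType) (c : J -> R[i]) (F : J -> 'rV[R]_n -> R[i]) eps :
  (forall j, L2 (F j)) -> (forall j, norm2 (F j) <= eps) ->
  norm2 (fun x => \sum_j c j * F j x) <= (\sum_j Normc.normc (c j)) * eps.
Proof.
move=> LF Feps; rewrite unlock; elim: (index_enum J) => [|j r IHr] /=.
  rewrite mul0r (_ : (fun x => 0) = fun _ : 'rV[R]_n => 0 * 0).
    by rewrite norm2Z ?Normc.normc0 ?mul0r//; exact: L2_zero.
  by apply/funext => x; rewrite mulr0.
apply: le_trans (norm2D (L2Z (c j) (LF j)) _) _.
  by have := L2_sum r c LF; rewrite unlock.
rewrite mulrDl lerD// norm2Z//; apply: ler_wpM2l => //; exact: normc_ge0.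
Qed.

Lemma near_span_sum (J : finType) (c : J -> R[i]) (h : J -> 'rV[R]_n -> R[i]) eps :
  (forall j, L2 (h j)) -> (forall j, near_span eps (h j)) ->
  near_span ((\sum_j Normc.normc (c j)) * eps) (fun x => \sum_j c j * h j x).
Proof.
move=> Lh /choice[a Ha].
exists (fun i => \sum_j c j * a j i).
rewrite (_ : (fun x => _) =
    fun x => \sum_j c j * (h j x - \sum_i a j i * G i x)).
  apply: norm2_sum => // j; apply: L2B => //; exact: L2_sum.
apply/funext => x; under [RHS]eq_bigr do rewrite mulrBr mulr_sumr.
rewrite sumrB exchange_big/=; congr (_ - _); apply: eq_bigr => i _.
by rewrite mulr_suml; apply: eq_bigr => j _; rewrite mulrA.
Qed.

(** Write U s (G i) as a combination of the G j plus a remainder and apply U t. The combination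
    multiplies the error by at most the row sum K, and the remainder keeps its norm because U t is
    an isometry. *)
Lemma near_span_step t s eps eta K (c : I -> I -> R[i]) : 0 <= eps ->
  (forall i, near_span eps (U t (G i))) ->
  (forall i, norm2 (fun x => U s (G i) x - \sum_j c i j * G j x) <= eta) ->
  (forall i, \sum_j Normc.normc (c i j) <= K) ->
  forall i, near_span (K * eps + eta) (U (t + s) (G i)).
Proof.
move=> eps0 Ht Hs HK i.
pose v x := \sum_j c i j * G j x.
pose r x := U s (G i) x - v x.
have Lv : L2 v by exact: L2_sum.
have Lr : L2 r by apply: L2B => //; exact: UL2.
have Lu : L2 (fun x => \sum_j c i j * U t (G j) x).
  by apply: L2_sum => j; exact: UL2.
apply: (@near_span_ae _ _ (fun x => \sum_j c i j * U t (G j) x + U t r x)).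
- exact: UL2.
- by apply: L2D => //; exact: UL2.
- have H1 := group_D U_group t s (LG i).
  have H2 := group_add t Lv Lr.
  have H3 := group_sum t (index_enum I) (c i) LG.
  have E : (fun x => v x + r x) = U s (G i).
    by apply/funext => x; rewrite /r addrC subrK.
  rewrite E in H2.
  move: H1 H2 H3; apply: filterS3.
  by move=> x /(_ Logic.I) -> /(_ Logic.I) -> /(_ Logic.I) E3 _; rewrite E3.
have [a Ha] := near_span_sum (c i) (fun j => UL2 t (LG j)) Ht.
apply: near_spanD => //; first exact: UL2.
  by exists a; apply: le_trans Ha _; apply: ler_wpM2r.
by rewrite norm2_group//; exact: Hs.
Qed.

End span.
End dynamics.

Section integral_monotone.
Context d (T : measurableType d) {R : realType} (m : {measure set T -> \bar R}).
Local Open Scope ereal_scope.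
Import HBNNSimple.

(* The integral of a nonnegative function is a supremum over simple functions,
   so it is monotone even without measurability. *)
Lemma le_integral_nonneg (f g : T -> \bar R) : (forall x, 0 <= f x) ->
  (forall x, f x <= g x) -> \int[m]_x f x <= \int[m]_x g x.
Proof.
move=> f0 fg; rewrite !ge0_integralTE//; last by move=> x; exact: le_trans (fg x).
apply: le_ereal_sup => _ [h hf <-]; exists h => // x.
exact: le_trans (fg x).
Qed.

Lemma ae_le_integral_nonneg (f g : T -> \bar R) : measurable_fun setT f ->
  (forall x, 0 <= f x) -> (forall x, 0 <= g x) -> {ae m, forall x, f x <= g x} ->
  \int[m]_x f x <= \int[m]_x g x.
Proof.
move=> mf f0 g0 [N [mN N0 fgN]].
rewrite (ge0_negligible_integral mN measurableT mf (fun x _ => f0 x) N0).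
rewrite integral_mkcond; apply: le_integral_nonneg => x.
  by rewrite patchE; case: ifPn.
rewrite patchE; case: ifPn => // /set_mem[_ xN].
by apply: contrapT => H; apply: xN; exact: fgN.
Qed.

End integral_monotone.

(** * Euler's method for the group *)

Section generator.
Context {R : realType} {n : nat}.
Variables (roots : {fset 'rV[R]_n}) (k : 'rV[R]_n -> R) (b : 'rV[R]_n).
Hypothesis roots_sys : root_system roots.
Hypothesis k_ge0 : forall a, a \in roots -> 0 <= k a.
Variable U : R -> ('rV[R]_n -> R[i]) -> ('rV[R]_n -> R[i]).
Hypothesis U_group : dunkl_hermite_group roots k b U.
Local Notation mu := (dunkl_nmeasure roots k).
Local Notation L2 := (in_L2 roots k).
Local Notation L2norm := (L2norm roots k).
Local Notation norm2 := (norm2 roots k).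

Let UL2 t f : L2 f -> L2 (U t f).
Proof. exact: group_L2 U_group _ _. Qed.

(** An inequality instead of an equality: g will contain [dunkl_hermite], which is controlled only
    off the walls and so is not known to be measurable. *)
Lemma L2norm_ae_le (f g : 'rV[R]_n -> R[i]) : cmeasurable f ->
  {ae mu, forall x, f x = g x} -> (L2norm f <= L2norm g)%E.
Proof.
move=> mf fg; rewrite !L2normE; apply: gt0_ler_poweR => //.
- by rewrite in_itv/= leey andbT integral_ge0// => x _; rewrite lee_fin sqr_ge0.
- by rewrite in_itv/= leey andbT integral_ge0// => x _; rewrite lee_fin sqr_ge0.
apply: ae_le_integral_nonneg => [|x|x|].
- by apply: measurableT_comp => //; apply: measurable_funX; exact: cmeasurable_normc.
- by rewrite lee_fin sqr_ge0.
- by rewrite lee_fin sqr_ge0.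
by move: fg; apply: filterS => x ->.
Qed.

Lemma normc_i : Normc.normc ('i%C : R[i]) = 1.
Proof. by rewrite /= expr0n/= add0r expr1n sqrtr1. Qed.

(** The generator axiom read as a first-order expansion with error o (s), in which the Dunkl-Hermite
    operator is replaced by the polynomial that it equals almost everywhere. *)
Lemma group_first_order d f : pol d.+1 f -> exists2 g, pol d.+1 g &
  forall eta, 0 < eta -> \forall s \near (0 : R)^',
    norm2 (fun x => U s (cgauss f) x -
      (cgauss f x - 'i%C * s%:C%C * cgauss g x)) <= eta * `|s|.
Proof.
move=> pf; have [P EP] := pol_meval pf.
have [g pg Hg] := dunkl_hermite_pol k b roots_sys pf.
exists g => // eta eta0.
have Lf : L2 (cgauss f) by exact: cgauss_L2 pf.
have Lg : L2 (cgauss g) by exact: cgauss_L2 pg.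
have EG x : poly_gauss P x = f x * gauss x by rewrite /poly_gauss EP.
have /= := group_generator U_group P.
rewrite (_ : (fun x => (poly_gauss P x)%:C%C) = cgauss f); last first.
  by apply/funext => x; rewrite EG.
move=> /fine_cvgP[fin_near /cvgr0_norm_lt/(_ eta eta0)].
move: (nbhs_dnbhs_neq (0 : R)) fin_near; apply: filterS3 => s s0 Ffin Feta.
set F := (fun x => _ + _) in Ffin Feta.
(* F' agrees with F off the walls, and unlike F it is visibly in L^2. *)
pose F' x := (s^-1)%:C%C * (U s (cgauss f) x - cgauss f x) + 'i%C * cgauss g x.
have LF' : L2 F' by apply: L2D; apply: L2Z => //; apply: L2B => //; exact: UL2.
have F'F : (L2norm F' <= L2norm F)%E.
  apply: L2norm_ae_le; first exact: L2_cmeasurable LF'.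
  apply: ae_dunkl_nmeasure; have := off_walls_ae roots_sys.
  by apply: filterS => x ox; rewrite /F /F' (Hg _ EG _ ox) EG.
have nF' : norm2 F' <= eta.
  rewrite -lee_fin -(L2_fin LF'); apply: le_trans F'F _.
  rewrite -(fineK Ffin) lee_fin; apply: le_trans (ltW Feta).
  exact: ler_norm.
rewrite (_ : (fun x => _) = fun x => s%:C%C * F' x).
  by rewrite norm2Z// normcR mulrC ler_wpM2r.
apply/funext => x; rewrite /F' mulrDr mulrA -rmorphM mulfV// rmorph1 mul1r.
ring.
Qed.

Lemma near_span_at0 (J : finType) (G : J -> 'rV[R]_n -> R[i]) :
  (forall j, L2 (G j)) -> forall j, near_span roots k G 0 (U 0 (G j)).
Proof.
move=> LG j; apply: (near_span_ae LG _ _ (group_0 U_group (LG j))) => //; first exact: UL2.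
exists (fun l => (j == l)%:R); rewrite (_ : (fun x => _) = fun _ => 0 * 0).
  by rewrite norm2Z ?Normc.normc0 ?mul0r//; exact: L2_zero.
apply/funext => x; rewrite mulr0 (bigD1 j)//= eqxx mul1r big1 ?addr0 ?subrr// => l.
by rewrite eq_sym => /negPf ->; rewrite mul0r.
Qed.

Lemma near_span_le (J : finType) (G : J -> 'rV[R]_n -> R[i]) eps eps' h :
  eps <= eps' -> near_span roots k G eps h -> near_span roots k G eps' h.
Proof. by move=> ee [c Hc]; exists c; exact: le_trans ee. Qed.

(* Euler's method: U (t / m) moves a generator within the span up to
   o (1 / m), and m such steps accumulate an error o (1). *)
Lemma near_span_group d : exists (I : finType) (e : I -> 'rV[R]_n -> R),
  [/\ forall i, pol d.+1 (e i),
      forall f, pol d.+1 f -> exists c : I -> R, forall x, f x = \sum_i c i * e i x &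
      forall t eps i, 0 < eps ->
        near_span roots k (fun i => cgauss (e i)) eps (U t (cgauss (e i)))].
Proof.
have [I [e [pe He]]] := @pol_generators R n d.+1.
exists I, e; split=> // t eps i0 eps0.
have Q i : exists2 g, pol d.+1 g & forall eta, 0 < eta -> \forall s \near (0 : R)^',
    norm2 (fun x => U s (cgauss (e i)) x -
      (cgauss (e i) x - 'i%C * s%:C%C * cgauss g x)) <= eta * `|s|.
  exact: group_first_order.
have {Q} Q i : exists a : I -> R, forall eta, 0 < eta -> \forall s \near (0 : R)^',
    norm2 (fun x => U s (cgauss (e i)) x -
      \sum_j ((i == j)%:R - 'i%C * s%:C%C * (a j)%:C%C) * cgauss (e j) x) <= eta * `|s|.
  have [g pg Hg] := Q i; have [a Ea] := He _ pg; exists a => eta eta0.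
  have := Hg _ eta0; apply: filterS => s.
  congr (norm2 _ <= _); apply/funext => x; congr (_ - _).
  under eq_bigr do rewrite mulrBl.
  rewrite sumrB; congr (_ - _).
    by rewrite (bigD1 i)//= eqxx mul1r big1 ?addr0// => j; rewrite eq_sym => /negPf ->; rewrite mul0r.
  rewrite {1}/cgauss Ea mulr_suml rmorph_sum mulr_sumr; apply: eq_bigr => j _.
  by rewrite -[a j * _ * _]mulrA rmorphM mulrA.
have {Q} [a Ha] := choice Q.
pose C := \sum_i \sum_j `|a i j|.
have C0 : 0 <= C by apply: sumr_ge0 => i _; apply: sumr_ge0.
have LG i : L2 (cgauss (e i)) by exact: cgauss_L2 (pe i).
have [->|t0] := eqVneq t 0.
  by apply: near_span_le (near_span_at0 LG i0); exact: ltW.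
(* The accumulated error will be eta |t| exp (C |t|), which this choice makes equal to eps. *)
pose eta := eps / (`|t| * expR (C * `|t|)).
have eta0 : 0 < eta by rewrite divr_gt0// mulr_gt0 ?normr_gt0// expR_gt0.
have : \forall s \near (0 : R)^', forall i, norm2 (fun x => U s (cgauss (e i)) x -
      \sum_j ((i == j)%:R - 'i%C * s%:C%C * (a i j)%:C%C) * cgauss (e j) x) <= eta * `|s|.
  by apply: filter_forall => i; exact: Ha.
move=> /nbhs_ballP[delta /= delta0 Hd].
have [m mt] : exists m : nat, `|t| / delta < m.+1%:R.
  exists (Num.bound (`|t| / delta)).
  apply: lt_le_trans (archi_boundP _) _; last by rewrite ler_nat.
  by rewrite divr_ge0// ltW.
pose s := t / m.+1%:R.
have s0 : s != 0 by rewrite mulf_neq0// invr_eq0 pnatr_eq0.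
have sd : `|s| < delta.
  rewrite normrM normfV [X in _ / X]ger0_norm// ltr_pdivrMr ?ltr0n//.
  by rewrite mulrC -ltr_pdivrMr.
have {Hd} Hs := Hd s; rewrite /ball/= sub0r normrN in Hs; have {Hs} Hs := Hs sd s0.
have HK i : \sum_j Normc.normc ((i == j)%:R - 'i%C * s%:C%C * (a i j)%:C%C) <= 1 + C * `|s|.
  apply: (@le_trans _ _ (\sum_j ((i == j)%:R + `|s| * `|a i j|))).
    apply: ler_sum => j _; apply: le_trans (le_normcD _ _) _; apply: lerD.
      by case: eqP => _; rewrite ?Normc.normc1 ?Normc.normc0.
    by rewrite normcN !Normc.normcM normc_i mul1r !normcR.
  rewrite big_split/= (bigD1 i)//= eqxx big1 ?addr0 => [|j]; last first.
    by rewrite eq_sym => /negPf ->.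
  rewrite lerD2l -mulr_sumr mulrC ler_wpM2r// /C [leRHS](bigD1 i)//= lerDl.
  by apply: sumr_ge0 => l _; apply: sumr_ge0.
(* Discrete Gronwall argument: each step multiplies the error by at most 1 + C |s| <= exp (C |s|)
   and adds eta |s|. *)
have step l : forall i, near_span roots k (fun i => cgauss (e i))
    (eta * (l%:R * `|s|) * expR (C * (l%:R * `|s|))) (U (l%:R * s) (cgauss (e i))).
  elim: l => [|l IHl] i.
    by rewrite !(mul0r, mulr0); exact: near_span_at0.
  rewrite -natr1 !mulrDl !mul1r.
  have x0 : 0 <= l%:R * `|s| by rewrite mulr_ge0.
  have eps'0 : 0 <= eta * (l%:R * `|s|) * expR (C * (l%:R * `|s|)).
    by rewrite !mulr_ge0 ?expR_ge0// ltW.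
  apply: near_span_le (near_span_step U_group LG eps'0 IHl Hs HK i).
  rewrite [C * (_ + _)]mulrDr expRD [eta * (_ + _)]mulrDr [leRHS]mulrDl; apply: lerD.
    by rewrite mulrC [leRHS]mulrA ler_wpM2l// expR_ge1Dx.
  apply: ler_peMr; first by rewrite mulr_ge0// ltW.
  by rewrite -expRD -[leLHS]expR0 ler_expR addr_ge0// mulr_ge0.
have := step m.+1 i0.
have -> : m.+1%:R * s = t by rewrite mulrC divfK ?pnatr_eq0.
have -> : m.+1%:R * `|s| = `|t|.
  by rewrite normrM normfV [X in _ / X]ger0_norm// mulrC divfK ?pnatr_eq0.
by rewrite -mulrA divfK// mulf_neq0 ?normr_eq0// gt_eqF// expR_gt0.
Qed.

End generator.

(** * Concentration of the evolved functions in a ball *)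

Section group_concentration.
Context {R : realType} {n : nat}.
Variables (roots : {fset 'rV[R]_n}) (k : 'rV[R]_n -> R) (b : 'rV[R]_n).
Hypothesis roots_sys : root_system roots.
Hypothesis k_ge0 : forall a, a \in roots -> 0 <= k a.
Variable U : R -> ('rV[R]_n -> R[i]) -> ('rV[R]_n -> R[i]).
Hypothesis U_group : dunkl_hermite_group roots k b U.
Local Notation mu := (dunkl_nmeasure roots k).
Local Notation L2 := (in_L2 roots k).
Local Notation L2norm := (L2norm roots k).
Local Notation norm2 := (norm2 roots k).
Implicit Types (h v : 'rV[R]_n -> R[i]) (S : set 'rV[R]_n).

Definition cut S h : 'rV[R]_n -> R[i] := fun x => (\1_S x)%:C%C * h x.

Lemma cut_L2 S h : measurable S -> L2 h -> L2 (cut S h).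
Proof.
move=> mS Lh; have mh := L2_cmeasurable Lh.
have mc : cmeasurable (cut S h).
  by apply: cmeasurableM => //; apply: cmeasurable_real; exact: measurable_indic.
apply: in_L2P => //; apply: le_lt_trans (_ : L2norm h < +oo)%E; last first.
  by rewrite (L2_fin Lh) ltry.
apply: L2norm_le => // x; rewrite Normc.normcM normcR indicE.
by case: (_ \in _); rewrite ?normr1 ?mul1r// normr0 mul0r normc_ge0.
Qed.

Lemma norm2_cut_le S h : measurable S -> L2 h -> norm2 (cut S h) <= norm2 h.
Proof.
move=> mS Lh; have Lc := cut_L2 mS Lh.
rewrite -lee_fin -(L2_fin Lh) -(L2_fin Lc).
apply: L2norm_le => [||x]; [exact: L2_cmeasurable Lc|exact: L2_cmeasurable Lh|].
rewrite Normc.normcM normcR indicE.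
by case: (_ \in _); rewrite ?normr1 ?mul1r// normr0 mul0r normc_ge0.
Qed.

Lemma norm2_cut S h : measurable S -> L2 h ->
  (\int[mu]_(x in S) (Normc.normc (h x) ^+ 2)%:E = (norm2 (cut S h) ^+ 2)%:E)%E.
Proof.
move=> mS Lh; rewrite -integral_normc2; last exact: cut_L2.
rewrite integral_mkcond; apply: eq_integral => x _.
rewrite patchE Normc.normcM normcR exprMn indicE.
by case: (_ \in _); rewrite ?normr1 ?normr0 ?expr1n ?mul1r// expr0n/= mul0r.
Qed.

(** [pol_tail] applies to the real and imaginary parts separately; its factor 1 / 4 on squared norms
    becomes 1 / 2. *)
Lemma norm2_tail d (I : finType) (e : I -> 'rV[R]_n -> R) (a : I -> R[i]) :
  (forall i, pol d.+1 (e i)) ->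
  norm2 (cut [set x | tail_radius roots k * d.+1%:R < dot x x]
    (fun x => \sum_i a i * cgauss (e i) x)) <=
  2^-1 * norm2 (fun x => \sum_i a i * cgauss (e i) x).
Proof.
move=> pe; set S := [set x | _]; set v := fun x => _.
have mS : measurable S by exact: measurable_dot_gt.
have Lv : L2 v by apply: L2_sum => i; exact: cgauss_L2 (pe i).
pose v1 x := \sum_i complex.Re (a i) * e i x.
pose v2 x := \sum_i complex.Im (a i) * e i x.
have p1 : pol d.+1 v1 by apply: pol_sum => i; exact: polZ.
have p2 : pol d.+1 v2 by apply: pol_sum => i; exact: polZ.
have Ev x : v x = ((v1 x * gauss x) +i* (v2 x * gauss x))%C.
  rewrite /v /v1 /v2 !mulr_suml; elim/big_ind3 : _ => //.
    by move=> x1 x2 x3 y1 y2 y3 -> ->.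
  by move=> i _; case: (a i) => p q; rewrite /cgauss -!mulrA; congr Complex;
    rewrite ?mulr0 ?subr0 ?add0r.
have Nv x : Normc.normc (v x) ^+ 2 = v1 x ^+ 2 * expR (- 1 * dot x x) +
    v2 x ^+ 2 * expR (- 1 * dot x x).
  by rewrite normc_sqr Ev/= !exprMn gauss_sqr.
have m1 := measurable_sqr_expR (- 1) p1.
have m2 := measurable_sqr_expR (- 1) p2.
have H : (\int[mu]_(x in S) (Normc.normc (v x) ^+ 2)%:E <=
    (4^-1)%:E * \int[mu]_x (Normc.normc (v x) ^+ 2)%:E)%E.
  under eq_integral do rewrite Nv EFinD.
  under [X in (_ <= _ * X)%E]eq_integral do rewrite Nv EFinD.
  rewrite !ge0_integralD//=; try by [move=> x _; exact: sqr_expR_ge0|exact: measurable_funTS].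
  rewrite muleDr//; last first.
    by apply: ge0_adde_def; rewrite inE; apply: integral_ge0 => x _; exact: sqr_expR_ge0.
  by apply: leeD; apply: pol_tail.
move: H; rewrite norm2_cut// integral_normc2// -EFinM lee_fin => H.
have := norm2_ge0 roots k v; have := norm2_ge0 roots k (cut S v).
move: H; set x := norm2 _; set y := norm2 _ => H x0 y0.
rewrite -(@ler_pXn2r _ 2)// ?nnegrE ?mulr_ge0// exprMn exprVn.
by rewrite (_ : 2 ^+ 2 = 4)// -natrX.
Qed.

(** U t f has norm 1 and is within 1 / 10 of a polynomial times the Gaussian, so it inherits a tail
    bound from [norm2_tail]; the ball carries the rest of the mass. *)
Lemma group_concentration d f t : pol d.+1 f -> norm2 (cgauss f) = 1 ->
  ((2^-1)%:E <= \int[mu]_(x in [set x | (dot x x <= tail_radius roots k * d.+1%:R)%R])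
     (Normc.normc (U t (cgauss f) x) ^+ 2)%:E)%E.
Proof.
move=> pf f1; set K := _ * d.+1%:R; set B := [set x | _].
pose S : set 'rV[R]_n := [set x | K < dot x x].
have mB : measurable B by exact: measurable_dot_le.
have mS : measurable S by exact: measurable_dot_gt.
have Lf : L2 (cgauss f) by exact: cgauss_L2 pf.
have LU : L2 (U t (cgauss f)) by exact: (group_L2 U_group t Lf).
have [I [e [pe He NS]]] := near_span_group roots_sys k_ge0 U_group d.
have LG i : L2 (cgauss (e i)) by exact: cgauss_L2 (pe i).
have [c Ec] := He _ pf.
pose C := \sum_i Normc.normc ((c i)%:C%C).
have C0 : 0 <= C by apply: sumr_ge0 => i _; exact: normc_ge0.
(* The error allowed on each generator: the coefficients of f multiply it by at most C, so the total
   stays below 1 / 10. *)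
have eps0 : 0 < 10^-1 / (C + 1) by rewrite divr_gt0// ltr_wpDl.
have E1 : cgauss f = fun x => \sum_i (c i)%:C%C * cgauss (e i) x.
  apply/funext => x; rewrite {1}/cgauss Ec mulr_suml rmorph_sum; apply: eq_bigr => i _.
  by rewrite -mulrA rmorphM.
have LUe i : L2 (U t (cgauss (e i))) by exact: (group_L2 U_group t (LG i)).
have [a Ha] : near_span roots k (fun i => cgauss (e i)) 10^-1 (U t (cgauss f)).
  apply: (near_span_le (eps := C * (10^-1 / (C + 1)))).
    by rewrite mulrCA ler_piMr// ler_pdivrMr ?ltr_wpDl// mul1r lerDl.
  apply: (near_span_ae LG LU (L2_sum (index_enum I) (fun i => (c i)%:C%C) LUe)).
    have := group_sum U_group t (index_enum I) (fun i => (c i)%:C%C) LG.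
    by apply: filterS => x + _ => /(_ Logic.I); rewrite -E1.
  apply: near_span_sum => // i; exact: NS.
pose v x := \sum_i a i * cgauss (e i) x.
have Lv : L2 v by exact: L2_sum.
pose w x := U t (cgauss f) x - v x.
have Lw : L2 w by exact: L2B.
have U1 : norm2 (U t (cgauss f)) = 1 by rewrite (norm2_group U_group).
have v1 : norm2 v <= 1 + 10^-1.
  have LNw : L2 (fun x => (- 1) * w x) by exact: L2Z.
  have := norm2D LU LNw; rewrite norm2Z// normcN Normc.normc1 mul1r U1.
  rewrite (_ : (fun x => _) = v); last by apply/funext => x; rewrite /w; ring.
  by move=> /le_trans; apply; rewrite lerD2l.
(* The bound is 0.65, whose square is below 1 / 2. *)
have tU : norm2 (cut S (U t (cgauss f))) <= 2^-1 * (1 + 10^-1) + 10^-1.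
  have := norm2D (cut_L2 mS Lv) (cut_L2 mS Lw).
  rewrite (_ : (fun x => _) = cut S (U t (cgauss f))); last first.
    by apply/funext => x; rewrite /cut /w; ring.
  move=> /le_trans; apply; apply: lerD.
    apply: le_trans (norm2_tail _ pe) _.
    by rewrite ler_wpM2l.
  exact: le_trans (norm2_cut_le mS Lw) Ha.
have split1 : (\int[mu]_(x in B) (Normc.normc (U t (cgauss f) x) ^+ 2)%:E +
    \int[mu]_(x in S) (Normc.normc (U t (cgauss f) x) ^+ 2)%:E = 1)%E.
  rewrite -ge0_integral_setU//=.
  - rewrite (_ : B `|` S = setT).
      by rewrite integral_normc2// U1 expr1n.
    by rewrite -subTset => x _; rewrite /B /S/=; case: leP; [left|right].
  - apply: measurable_funTS; apply: measurableT_comp => //; apply: measurable_funX.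
    exact: cmeasurable_normc (L2_cmeasurable LU).
  - by move=> x _; rewrite lee_fin sqr_ge0.
  by apply/disj_setPS => x []; rewrite /B /S/= leNgt => /negP.
move: split1; rewrite !norm2_cut// -EFinD => -[].
have := norm2_ge0 roots k (cut S (U t (cgauss f))).
move: tU; set y := norm2 (cut S _); set z := norm2 _ ^+ 2 => yb y0 zy.
rewrite lee_fin; nra.
Qed.

End group_concentration.

(** * Orthonormal polynomials *)

Section monomials.
Context {R : realType} {n : nat}.
Implicit Types (f g : 'rV[R]_n -> R).

Lemma polM d f g : pol d f -> (exists e, pol e g) -> exists e, pol e (fun x => f x * g x).
Proof.
move=> pf [e pg]; elim: pf => {d f} [d|d c|d f f' _ [a pa] _ [a' pa']|d i f _ [a pa]].
- by exists 0%N; under eq_fun do rewrite mul0r; exact: pol_zero.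
- by exists e; exact: polZ.
- exists (maxn a a'); under eq_fun do rewrite mulrDl.
  by apply: polD; [apply: pol_le pa; exact: leq_maxl|apply: pol_le pa'; exact: leq_maxr].
- by exists a.+1; under eq_fun do rewrite -mulrA; exact: polX.
Qed.

Lemma polXn d m i f : pol d f -> pol (m + d) (fun x => x ord0 i ^+ m * f x).
Proof.
move=> pf; elim: m => [|m IHm]; first by under eq_fun do rewrite mul1r.
by under eq_fun do rewrite exprS -mulrA; exact: polX.
Qed.

(* Base-N digits enumerate the exponents, so that substituting t ^ (N ^ i) for
   the i-th coordinate turns the b-th monomial into t ^ b (Kronecker). *)
Definition monomial (N b : nat) (x : 'rV[R]_n) : R :=
  \prod_(i < n) x ord0 i ^+ (b %/ N ^ i %% N).

Lemma pol_monomial N b : (0 < N)%N -> pol (n * N).+1 (monomial N b).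
Proof.
move=> N0; apply: (@pol_le _ _ (\sum_(i < n) (b %/ N ^ i %% N)).+1).
  rewrite ltnS -[n in (n * N)%N]card_ord -sum_nat_const; apply: leq_sum => i _.
  by rewrite ltnW// ltn_mod.
rewrite /monomial; elim: (index_enum 'I_n) => [|i r IHr].
  by rewrite big_nil; under eq_fun do rewrite big_nil; exact: pol_cst.
rewrite big_cons -addnS; have := polXn (b %/ N ^ i %% N) i IHr; congr (pol _ _).
by apply/funext => x; rewrite big_cons.
Qed.

Lemma digits_sum N b m : (0 < N)%N -> (\sum_(i < m) N ^ i * (b %/ N ^ i %% N))%N = (b %% N ^ m)%N.
Proof.
move=> N0; elim: m => [|m IHm]; first by rewrite big_ord0 modn1.
have E : b = (b %/ N ^ m %/ N * N ^ m.+1 + (b %/ N ^ m %% N * N ^ m + b %% N ^ m))%N.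
  by rewrite addnA expnS mulnA -mulnDl -!divn_eq.
rewrite big_ord_recr/= IHm [in RHS]E modnMDl [X in _ = X]modn_small; first by rewrite addnC [(N ^ m * _)%N]mulnC.
have rN : (b %/ N ^ m %% N < N)%N by rewrite ltn_mod.
have sN : (b %% N ^ m < N ^ m)%N by rewrite ltn_mod expn_gt0 N0.
rewrite expnS; apply: (@leq_trans ((b %/ N ^ m %% N).+1 * N ^ m)).
  by rewrite mulSn addnC ltn_add2r.
by rewrite leq_mul2r rN orbT.
Qed.

Lemma monomial_kronecker N b (t : R) : (0 < N)%N -> (b < N ^ n)%N ->
  monomial N b (\row_i t ^+ (N ^ i)) = t ^+ b.
Proof.
move=> N0 bN; rewrite -[in RHS](modn_small bN) -digits_sum//.
rewrite -prodrXr /monomial; apply: eq_bigr => i _.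
by rewrite mxE -exprM.
Qed.

(** After the Kronecker substitution, the c b are the coefficients of a univariate polynomial that
    vanishes everywhere. *)
Lemma monomial_free N (c : 'I_(N ^ n) -> R) : (0 < N)%N ->
  (forall x, \sum_b c b * monomial N b x = 0) -> forall b, c b = 0.
Proof.
move=> N0 c0 b.
pose p : {poly R} := \sum_b c b *: 'X^b.
have pt t : p.[t] = 0.
  rewrite /p horner_sum; apply: etrans (c0 (\row_i t ^+ (N ^ i))).
  apply: eq_bigr => l _.
  by rewrite hornerZ hornerXn monomial_kronecker.
have p0 : p = 0.
  apply: (@roots_geq_poly_eq0 _ p [seq (i%:R : R) | i <- iota 0 (size p)]).
  - by apply/allP => t _; exact/rootP.
  - by rewrite map_inj_uniq ?iota_uniq// => i j /eqP; rewrite eqr_nat => /eqP.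
  - by rewrite size_map size_iota.
have := congr1 (fun q : {poly R} => q`_b) p0; rewrite coef0 /p coef_sum.
rewrite (bigD1 b)//= coefZ coefXn eqxx mulr1 big1 ?addr0// => l /negPf lb.
by rewrite coefZ coefXn (inj_eq val_inj) eq_sym lb mulr0.
Qed.

End monomials.

(** * Construction of the orthonormal sequence *)

Section orthonormal_polynomials.
Context {R : realType} {n : nat}.
Variables (roots : {fset 'rV[R]_n}) (k : 'rV[R]_n -> R).
Hypothesis n_ge1 : (1 <= n)%N.
Hypothesis roots_sys : root_system roots.
Hypothesis k_ge0 : forall a, a \in roots -> 0 <= k a.
Local Notation mu := (dunkl_nmeasure roots k).
Local Notation inner := (L2inner roots k).
Implicit Types (f g h : 'rV[R]_n -> R).

Definition ip f g : R := (\int[mu]_x (f x * g x * expR (- 1 * dot x x)))%R.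

Lemma inner_cgauss f g : inner (cgauss f) (cgauss g) = (ip f g)%:C%C.
Proof.
rewrite /Defs.L2inner; congr Complex.
  apply: eq_Rintegral => x _; rewrite /= -gauss_sqr; ring.
rewrite /Rintegral integral0_eq// => x _.
by rewrite /= oppr0 mulr0 mul0r addr0.
Qed.

Lemma pol_integrable d h : pol d h ->
  mu.-integrable setT (EFin \o (fun x => h x * expR (- 1 * dot x x))).
Proof.
move=> ph; apply/integrableP; split.
  apply: measurableT_comp => //; apply: measurable_funM.
    exact: measurable_pol ph.
  exact: measurable_expR_dot.
have e0 : 0 < 2^-1 :> R by [].
have [C C0 hC] := pol_bound e0 ph.
have me : measurable_fun setT (fun x : 'rV[R]_n => (expR (- 2^-1 * dot x x))%:E).
  by apply: measurableT_comp => //; exact: measurable_expR_dot.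
have e1 (x : 'rV[R]_n) : setT x -> (0 <= (expR (- 2^-1 * dot x x))%:E)%E.
  by move=> _; rewrite lee_fin expR_ge0.
have C1 : (0 <= C%:E)%E by rewrite lee_fin.
apply: (@le_lt_trans _ _ (\int[mu]_x (C%:E * (expR (- 2^-1 * dot x x))%:E))%E).
  apply: le_integral_nonneg => x; first exact: abse_ge0.
  rewrite abse_EFin -EFinM lee_fin normrM [X in _ * X]ger0_norm ?expR_ge0//.
  apply: le_trans (ler_wpM2r (expR_ge0 _) (hC x)) _.
  rewrite -mulrA -expRD ler_wpM2l// ler_expR; lra.
rewrite (ge0_integralZl mu measurableT me e1 C1); apply: lte_mul_pinfty => //.
rewrite (ge0_integral_mscale _ measurableT _ me e1).
by apply: lte_mul_pinfty => //; exact: integral_gauss_nu.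
Qed.

Lemma pol_integrableM d e f g : pol d f -> pol e g ->
  mu.-integrable setT (EFin \o (fun x => f x * g x * expR (- 1 * dot x x))).
Proof.
move=> pf pg; have [c pc] := polM pf (ex_intro _ e pg).
exact: pol_integrable pc.
Qed.

Lemma ipC f g : ip f g = ip g f.
Proof. by apply: eq_Rintegral => x _; rewrite [f x * g x]mulrC. Qed.

Lemma ip_sum d e (I : Type) (r : seq I) (c : I -> R) (F : I -> 'rV[R]_n -> R) g :
  (forall i, pol d (F i)) -> pol e g ->
  ip (fun x => \sum_(i <- r) c i * F i x) g = \sum_(i <- r) c i * ip (F i) g.
Proof.
move=> pF pg; elim: r => [|i r IHr].
  rewrite big_nil /ip /Rintegral integral0_eq// => x _.
  by rewrite big_nil !mul0r.
rewrite big_cons -IHr /ip -RintegralZl//; last exact: pol_integrableM (pF i) pg.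
rewrite -RintegralD//.
- by apply: eq_Rintegral => x _; rewrite big_cons; ring.
- have := pol_integrableM (polZ (c i) (pF i)) pg.
  by congr (_.-integrable _ _); apply/funext => x /=; rewrite !mulrA.
- apply: pol_integrableM pg; apply: (@pol_sum _ _ d) => j; exact: polZ.
Qed.

Lemma ipZZ d (c : R) f : pol d f ->
  ip (fun x => c * f x) (fun x => c * f x) = c ^+ 2 * ip f f.
Proof.
move=> pf; rewrite /ip -RintegralZl//; last exact: (pol_integrableM pf pf).
by apply: eq_Rintegral => x _; ring.
Qed.

Lemma ip_gt0 d h x0 : pol d h -> h x0 != 0 -> 0 < ip h h.
Proof.
move=> ph h0.
have m2 := measurable_sqr_expR (- 1) ph.
have H := integral_pol_gt0 k roots_sys ph h0 (@measurable_expR_dot R n (- 1))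
  (fun x => expR_gt0 _).
rewrite /ip /Rintegral fine_gt0//; apply/andP; split.
  under eq_integral do rewrite -expr2.
  rewrite ge0_integral_mscale//; last by move=> x _; exact: sqr_expR_ge0.
  by apply: mule_gt0 => //; rewrite lte_fin; exact: dunkl_c_gt0.
under eq_integral do rewrite -expr2.
exact: pol_gauss_fin ph.
Qed.

(** Quantifying over N lets a single sequence serve all scales: for each N, its first N^n members
    have degree at most n N. *)
Definition good_degree j f : Prop :=
  forall N, (j < N ^ n)%N -> pol (n * N).+1 f.

Lemma good_degree_pol j f : good_degree j f -> pol (n * j.+1).+1 f.
Proof.
apply; case: (n) n_ge1 => // m _; rewrite expnS.
apply: leq_pmulr; by rewrite expn_gt0.
Qed.

(** For the least N with j < N^n, orthogonality to the j given functions imposes j linear conditions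
    on N^n free monomials, so a nonzero solution exists and can be normalized. Minimality of N gives
    [good_degree]. *)
Lemma orthonormal_extension (s : seq ('rV[R]_n -> R)) :
  (forall i, (i < size s)%N -> good_degree i (nth (fun _ => 0) s i)) ->
  exists f, [/\ good_degree (size s) f, ip f f = 1 &
    forall i, (i < size s)%N -> ip f (nth (fun _ => 0) s i) = 0].
Proof.
move=> sgood; set j := size s.
have exN : exists N, (j < N ^ n)%N.
  exists j.+1; case: (n) n_ge1 => // m _; rewrite expnS.
  by apply: leq_pmulr; rewrite expn_gt0.
case: (ex_minnP exN) => N jN minN.
have N0 : (0 < N)%N by move: jN; case: (N) => //; rewrite exp0n.
pose A := \matrix_(b < N ^ n, i < j) ip (@monomial R n N b) (nth (fun _ => 0) s i).
(* A has more rows than columns; a row vector v with v A = 0 lists the coefficients of a combination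
   orthogonal to s. *)
have kA : kermx A != 0.
  rewrite -mxrank_eq0 mxrank_ker subn_eq0 -ltnNge.
  exact: leq_ltn_trans (rank_leq_col A) jN.
have /rowV0Pn[v /sub_kermxP vA v0] := kA.
pose h x := \sum_b v ord0 b * @monomial R n N b x.
have ph : pol (n * N).+1 h by apply: pol_sum => b; apply: polZ; exact: pol_monomial.
have [x0 hx0] : exists x0, h x0 != 0.
  apply: contrapT => H; move/eqP: v0; apply; apply/rowP => b; rewrite mxE.
  apply: (@monomial_free R n N (fun b => v ord0 b)) => // x.
  by apply/eqP; apply: contrapT => Hx; apply: H; exists x; exact/negP.
have hh := ip_gt0 ph hx0.
pose c := (Num.sqrt (ip h h))^-1.
exists (fun x => c * h x); split.
- move=> M jM; apply: polZ; apply: pol_le ph.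
  by rewrite ltnS leq_mul2l minN ?orbT.
- rewrite (ipZZ c ph) /c exprVn sqr_sqrtr ?ltW// mulVf// gt_eqF//.
move=> i ij.
have Ei : ip h (nth (fun=> 0) s i) = 0.
  have E := ip_sum (index_enum 'I_(N ^ n)) (fun b => v ord0 b)
    (fun b : 'I_(N ^ n) => pol_monomial b N0) (good_degree_pol (sgood _ ij)).
  apply: etrans E _.
  have := congr1 (fun B : 'rV_j => B ord0 (Ordinal ij)) vA; rewrite !mxE.
  apply: etrans.
  by apply: eq_bigr => b _; rewrite mxE.
have := @ip_sum (n * N).+1 _ _ [:: tt] (fun=> c) (fun=> h) _ (fun=> ph)
  (good_degree_pol (sgood _ ij)).
rewrite big_seq1 Ei mulr0; apply: etrans.
by apply: eq_Rintegral => x _; rewrite big_seq1.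
Qed.

Lemma orthonormal_polynomials : exists f : nat -> 'rV[R]_n -> R,
  (forall j, good_degree j (f j)) /\
  (forall i j, inner (cgauss (f i)) (cgauss (f j)) = (i == j)%:R).
Proof.
(* The hypothesis on s is part of P so that [choice] yields an extension function defined on all
   lists. *)
pose P (s : seq ('rV[R]_n -> R)) (f : 'rV[R]_n -> R) :=
  (forall i, (i < size s)%N -> good_degree i (nth (fun _ => 0) s i)) ->
  [/\ good_degree (size s) f, ip f f = 1 &
    forall i, (i < size s)%N -> ip f (nth (fun _ => 0) s i) = 0].
have exP s : exists f, P s f.
  have [sg|sg] := pselect (forall i, (i < size s)%N -> good_degree i (nth (fun _ => 0) s i)).
    by have [f Hf] := orthonormal_extension sg; exists f.
  by exists (fun _ => 0) => /sg.
have [ext Hext] := choice exP.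
pose S := fix S m := if m is m'.+1 then rcons (S m') (ext (S m')) else [::].
pose f j := ext (S j).
have SE m : S m = mkseq f m.
  elim: m => //= m IHm.
  by rewrite mkseqS -IHm.
have sS m : size (S m) = m by rewrite SE size_mkseq.
have nS m i : (i < m)%N -> nth (fun _ => 0) (S m) i = f i.
  by move=> im; rewrite SE nth_mkseq.
have main j : [/\ good_degree j (f j), ip (f j) (f j) = 1 &
    forall i, (i < j)%N -> ip (f j) (f i) = 0].
  elim/ltn_ind: j => j IHj.
  have [|] := Hext (S j).
    by rewrite sS => i ij; rewrite nS//; have [] := IHj _ ij.
  rewrite sS => g1 g2 g3; split=> // i ij.
  by have := g3 _ ij; rewrite nS.
exists f; split=> [j|i j]; first by have [] := main j.
rewrite inner_cgauss; have [->|ij] := eqVneq i j.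
  by have [_ -> _] := main j.
suff -> : ip (f i) (f j) = 0 by [].
have [lt_ij|lt_ji] := ltnP i j.
  by rewrite ipC; have [_ _ ->] := main j.
by have [_ _ ->//] := main i; rewrite ltn_neqAle eq_sym ij.
Qed.

End orthonormal_polynomials.

(** * Blow-up of the mixed norm *)

Section summability.
Context {R : realType}.

(** A discrete substitute for comparing the p-series with an integral. It follows from exp y >= 1 +
    y and ln (1 - 1 / (x + 1)) <= - 1 / (x + 1). *)
Lemma powR_diff_ge (beta x : R) : 0 < beta -> 0 < x ->
  beta * (x + 1) `^ (- (beta + 1)) <= x `^ (- beta) - (x + 1) `^ (- beta).
Proof.
move=> b0 x0; have y0 : 0 < x + 1 by rewrite addr_gt0.
have b0' := ltW b0.
have r0 : 0 < x / (x + 1) by rewrite divr_gt0.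
have L : 1 + beta / (x + 1) <= (x / (x + 1)) `^ (- beta).
  have -> : (x / (x + 1)) `^ (- beta) = expR (- beta * ln (x / (x + 1))).
    by rewrite /powR gt_eqF.
  apply: le_trans (expR_ge1Dx _); rewrite lerD2l mulNr -mulrN ler_wpM2l//.
  rewrite lerNr; have -> : x / (x + 1) = 1 + - (x + 1)^-1.
    by field; rewrite gt_eqF.
  by apply: le_ln1Dx; rewrite ltrN2 invf_lt1// ltrDr.
have -> : x `^ (- beta) = (x / (x + 1)) `^ (- beta) * (x + 1) `^ (- beta).
  rewrite -powRM; [|exact: ltW|exact: ltW].
  by rewrite divfK// gt_eqF.
have -> : (x + 1) `^ (- (beta + 1)) = (x + 1) `^ (- beta) / (x + 1).
  rewrite opprD powRD; last by apply/implyP => _; rewrite gt_eqF.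
  by rewrite powR_inv1// ltW.
have := powR_ge0 (x + 1) (- beta); set z := _ `^ _ => z0.
rewrite -[X in _ - X]mul1r -mulrBl [leLHS]mulrC -mulrA [leRHS]mulrC ler_wpM2l//.
by rewrite mulrC lerBrDl.
Qed.

Lemma pseries_partial_bound (sigma : R) m : 1 < sigma ->
  \sum_(j < m) (j.+1%:R : R) `^ (- sigma) <= 1 + (sigma - 1)^-1.
Proof.
move=> s1; pose beta := sigma - 1.
have b0 : 0 < beta by rewrite subr_gt0.
(* The subtracted power strengthens the induction hypothesis so that the bounds of [powR_diff_ge]
   telescope. *)
have main l : \sum_(j < l.+1) (j.+1%:R : R) `^ (- sigma) <=
    1 + beta^-1 * (1 - l.+1%:R `^ (- beta)).
  elim: l => [|l IHl]; first by rewrite big_ord1 !powR1 subrr mulr0 addr0.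
  rewrite big_ord_recr/=; apply: le_trans (lerD IHl (lexx _)) _.
  rewrite -addrA lerD2l -lerBrDl -mulrBr.
  have l0 : 0 < l.+1%:R :> R by rewrite ltr0n.
  have := powR_diff_ge b0 l0; rewrite natr1 /beta subrK.
  rewrite -ler_pdivlMl// => /le_trans; apply.
  rewrite ler_wpM2l ?invr_ge0 ?(ltW b0)//; lra.
case: m => [|m].
  by rewrite big_ord0 addr_ge0// invr_ge0 ltW.
apply: le_trans (main m) _; rewrite lerD2l -[leRHS]mulr1.
by rewrite ler_wpM2l ?invr_ge0 ?(ltW b0)// gerBl powR_ge0.
Qed.

Lemma lr_norm_powR (r : \bar R) (s : R) : (0 < r)%E -> 0 < s ->
  (forall r', r = r'%:E -> 1 < s * r') ->
  (lr_norm r (fun j => (j.+1%:R `^ (- s))%:C%C) < +oo)%E.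
Proof.
move=> r0 s0 sr; rewrite /lr_norm.
have E j : (Normc.normc ((j.+1%:R `^ (- s) : R)%:C%C))%:E = (j.+1%:R `^ (- s))%:E.
  by rewrite normcR ger0_norm// powR_ge0.
rewrite (eq_Lnorm _ _ (g := fun j => (j.+1%:R `^ (- s))%:E))//.
case: r r0 sr => [r| |]// r0 sr.
  rewrite lte_fin in r0; rewrite Lnorm_counting//; apply: poweR_lty.
  apply: (@le_lt_trans _ _ (1 + (s * r - 1)^-1)%:E); last exact: ltry.
  apply: lime_le.
    by apply: is_cvg_nneseries => j _ _; exact: poweR_ge0.
  apply: nearW => m; rewrite big_mkord.
  under eq_bigr => j _.
    rewrite abse_EFin poweR_EFin ger0_norm ?powR_ge0// -powRrM mulNr.
    over.
  by rewrite sumEFin lee_fin; apply: pseries_partial_bound; exact: sr.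
rewrite unlock; case: ifPn => // _; apply: (@le_lt_trans _ _ 1%E); last exact: ltry.
apply/ess_supP; apply: nearW => j /=.
rewrite lee_fin ger0_norm ?powR_ge0// powRN invf_le1 ?powR_gt0//.
by rewrite -[leLHS](powRr0 (j.+1%:R : R)) ler_powR ?ler1n// ltW.
Qed.

End summability.

Section Lp_lower_bound.
Context d (T : measurableType d) {R : realType} (m : {measure set T -> \bar R}).

Lemma concentrated_Lp_bound (rho : T -> R) (B : set T) (p m0 V : R) :
  1 <= p -> 0 < m0 -> 0 < V -> measurable B -> measurable_fun setT rho ->
  (forall x, 0 <= rho x) -> (m B <= V%:E)%E ->
  (m0%:E <= \int[m]_(x in B) (rho x)%:E)%E ->
  ((m0 / 2 * (m0 / (2 * V)) `^ (p - 1))%:E <= \int[m]_x (rho x `^ p)%:E)%E.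
Proof.
move=> p1 m00 V0 mB mrho rho0 BV rhoB.
(* With this level a V = m0 / 2: the constant term in the inequality below absorbs at most half of
   the mass on B. *)
set a := m0 / (2 * V).
have a0 : 0 < a by rewrite divr_gt0// mulr_gt0.
set I := (\int[m]_x _)%E.
have I0 : (0 <= I)%E by apply: integral_ge0 => x _; rewrite lee_fin powR_ge0.
have mp : measurable_fun setT (fun x => (rho x `^ p)%:E).
  by apply: measurableT_comp => //; exact: (measurableT_comp (measurable_powR p) mrho).
have p0 x : setT x -> (0 <= (rho x `^ p)%:E)%E by rewrite lee_fin powR_ge0.
(* Young's inequality in its crudest form replaces Hoelder's. *)
have young y : 0 <= y -> y <= a + a `^ (1 - p) * y `^ p.
  move=> y0; have [ya|ay] := leP y a.
    by apply: le_trans ya _; rewrite lerDl mulr_ge0 ?powR_ge0.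
  have y1 : 0 < y by apply: lt_trans ay.
  apply: (@le_trans _ _ (a `^ (1 - p) * y `^ p)); last by rewrite lerDr ltW.
  apply: (@le_trans _ _ (y `^ (1 - p) * y `^ p)).
    rewrite -powRD; last by apply/implyP => _; rewrite gt_eqF.
    by rewrite subrK powRr1// ltW.
  rewrite ler_wpM2r ?powR_ge0// -[1 - p]opprB !powRN lef_pV2 ?posrE ?powR_gt0//.
  by rewrite ge0_ler_powR ?nnegrE ?subr_ge0// ltW.
have c0 : (0 <= (a `^ (1 - p))%:E)%E by rewrite lee_fin powR_ge0.
have mB1 : measurable_fun B (fun x => ((a `^ (1 - p))%:E * (rho x `^ p)%:E)%E).
  by apply: measurable_funTS; exact: emeasurable_funM.
have H : (m0%:E <= (a * V)%:E + (a `^ (1 - p))%:E * I)%E.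
  apply: le_trans rhoB _.
  apply: (@le_trans _ _ (\int[m]_(x in B) (a%:E + (a `^ (1 - p))%:E * (rho x `^ p)%:E))%E).
    apply: ge0_le_integral => //.
    - by move=> x _; rewrite lee_fin.
    - by apply: measurable_funTS; exact: measurableT_comp.
    - exact: emeasurable_funD.
    by move=> x _; rewrite -EFinM -EFinD lee_fin young.
  rewrite ge0_integralD//; last 2 first.
  - by move=> x _; rewrite lee_fin ltW.
  - by move=> x _; rewrite mule_ge0// lee_fin powR_ge0.
  apply: leeD.
    rewrite integral_cst// [leRHS]EFinM; apply: lee_wpmul2l => //.
    by rewrite lee_fin ltW.
  rewrite -(ge0_integralZl m measurableT mp p0 c0).
  apply: ge0_subset_integral => //; first exact: emeasurable_funM.
  by move=> x _; rewrite mule_ge0// lee_fin powR_ge0.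
have [->|Ioo] := eqVneq I +oo%E; first by rewrite leey.
have Ifin : I \is a fin_num by rewrite ge0_fin_numE// ltey.
move: H; rewrite -(fineK Ifin) -EFinM -EFinD !lee_fin.
have -> : a * V = m0 / 2 by rewrite /a; field; rewrite gt_eqF.
have -> : a `^ (1 - p) = (a `^ (p - 1))^-1 by rewrite -powRN opprB.
have A0 : 0 < a `^ (p - 1) by rewrite powR_gt0.
rewrite -lerBlDl (_ : m0 - m0 / 2 = m0 / 2); last by field.
by rewrite ler_pdivlMl// mulrC.
Qed.

Lemma le_limn_esup (u : nat -> \bar R) (c : \bar R) M :
  (forall j, (M <= j)%N -> (c <= u j)%E) -> (c <= limn_esup u)%E.
Proof.
move=> cu; rewrite limn_esup_lim; apply: lime_ge; first exact: is_cvg_esups.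
apply: nearW => l; apply: ereal_sup_ge; exists (u (maxn l M)).
  by exists (maxn l M) => //=; exact: leq_maxl.
by apply: cu; exact: leq_maxr.
Qed.

Lemma Lnorm_cst_pinfty (q : \bar R) : (1 <= q)%E -> (0 < m setT)%E ->
  ('N[m]_q[cst +oo] = +oo)%E.
Proof.
move=> q1 mT; rewrite unlock; case: q q1 => [q| |]// q1.
  have q0 : 0 < q by rewrite (lt_le_trans ltr01).
  apply: eqy_poweR; first by rewrite invr_gt0.
  rewrite (eq_integral (cst +oo%E)) => [|x _]; last first.
    by apply: etrans (poweRyr (lt0r_neq0 q0)).
  by rewrite integral_cst// gt0_mulye.
rewrite mT; exact: ess_sup_cst.
Qed.

End Lp_lower_bound.

(** * Lower bound for the density and divergence *)

Section blow_up.
Context {R : realType} {n : nat}.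
Variables (roots : {fset 'rV[R]_n}) (k : 'rV[R]_n -> R) (b : 'rV[R]_n).
Hypothesis n_ge1 : (1 <= n)%N.
Hypothesis roots_sys : root_system roots.
Hypothesis k_ge0 : forall a, a \in roots -> 0 <= k a.
Variable U : R -> ('rV[R]_n -> R[i]) -> ('rV[R]_n -> R[i]).
Hypothesis U_group : dunkl_hermite_group roots k b U.
Local Notation mu := (dunkl_nmeasure roots k).
Local Notation L2 := (in_L2 roots k).
Local Notation norm2 := (norm2 roots k).
Local Notation D := (@dunkl_dim R n roots k).

Lemma ball_growth : exists2 C1, 0 < C1 & forall N, (0 < N)%N ->
  (mu [set x | (dot x x <= tail_radius roots k * (n * N).+1%:R)%R] <=
   (C1 * N%:R `^ (D / 2))%:E)%E.
Proof.
pose A := tail_radius roots k * n.+1%:R.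
have A0 : 0 < A by rewrite mulr_gt0 ?tail_radius_gt0.
pose V1 := mu [set x : 'rV[R]_n | (dot x x <= 1)%R].
have V1fin : V1 \is a fin_num by rewrite ge0_fin_numE ?measure_ge0//; exact: unit_ball_fin.
have V10 : 0 <= fine V1 by rewrite fine_ge0// measure_ge0.
have E0 : 0 < Num.sqrt A `^ D by rewrite powR_gt0// sqrtr_gt0.
(* The squared radius is at most A N because n N + 1 <= (n + 1) N; the + 1 makes the constant
   positive whatever V1 is. *)
exists (Num.sqrt A `^ D * (fine V1 + 1)) => [|N N0].
  by rewrite mulr_gt0// ltr_wpDl.
have N0' : 0 < N%:R :> R by rewrite ltr0n.
have s0 : 0 < Num.sqrt A * Num.sqrt N%:R by rewrite mulr_gt0 ?sqrtr_gt0.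
apply: (@le_trans _ _ (mu [set x | (dot x x <= (Num.sqrt A * Num.sqrt N%:R) ^+ 2)%R])).
  apply: le_measure; rewrite ?inE.
  - exact: measurable_dot_le.
  - exact: measurable_dot_le.
  move=> x /= /le_trans; apply.
  rewrite exprMn !sqr_sqrtr ?ler0n ?(ltW A0)// /A -[leRHS]mulrA ler_wpM2l ?(ltW (tail_radius_gt0 k_ge0))//.
  by rewrite -natrM ler_nat mulSn addnC -addn1 leq_add2l.
rewrite ball_measure// -/V1 -[X in (_ * X)%E](fineK V1fin) -EFinM lee_fin.
rewrite powRM ?sqrtr_ge0// -[Num.sqrt N%:R]powR12_sqrt// -powRrM [_^-1 * D]mulrC.
rewrite -[leLHS]mulrA [X in _ * X]mulrC [leLHS]mulrA.
rewrite ler_wpM2r ?powR_ge0// ler_wpM2l ?(ltW E0)//.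
by rewrite lerDl.
Qed.

Variable f : nat -> 'rV[R]_n -> R.
Hypothesis f_deg : forall j, good_degree j (f j).
Hypothesis f_norm : forall j, norm2 (cgauss (f j)) = 1.
Variables (s p : R).
Hypothesis s_gt0 : 0 < s.
Hypothesis p_ge1 : 1 <= p.

Let a (j : nat) : R := j.+1%:R `^ (- s).
Let rho t N (x : 'rV[R]_n) : R :=
  \sum_(j < N ^ n) a j * Normc.normc (U t (cgauss (f j)) x) ^+ 2.

Let LU t j : L2 (U t (cgauss (f j))).
Proof.
apply: (group_L2 U_group t).
exact: (cgauss_L2 k_ge0 (good_degree_pol n_ge1 (@f_deg j))).
Qed.

Lemma rho_ge0 t N x : 0 <= rho t N x.
Proof. by apply: sumr_ge0 => j _; rewrite mulr_ge0 ?powR_ge0 ?sqr_ge0. Qed.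

Lemma measurable_rho t N : measurable_fun setT (rho t N).
Proof.
apply: measurable_sum => j; apply: measurable_funM => //; apply: measurable_funX.
exact: cmeasurable_normc (L2_cmeasurable (LU t j)).
Qed.

Lemma density_ge t N x :
  ((rho t N x)%:E <=
   density (fun j => (a j)%:C%C) (fun j => U t (cgauss (f j))) x)%E.
Proof.
apply: (le_limn_esup (M := (N ^ n)%N)) => m Mm; rewrite lee_fin.
rewrite (_ : \sum_(j < m) _ =
    (\sum_(j < m) a j * Normc.normc (U t (cgauss (f j)) x) ^+ 2)%:C%C); last first.
  by rewrite rmorph_sum; apply: eq_bigr => j _; rewrite [RHS]rmorphM.
rewrite normcR (le_trans _ (ler_norm _))//.
pose g j := a j * Normc.normc (U t (cgauss (f j)) x) ^+ 2.
rewrite /rho -(big_mkord xpredT g) -(big_mkord xpredT g).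
rewrite [leRHS](@big_cat_nat _ _ _ (N ^ n)%N)//= lerDl.
by apply: sumr_ge0 => j _; rewrite mulr_ge0 ?powR_ge0 ?sqr_ge0.
Qed.

(** Each of the N^n terms has a coefficient at least that of the last one, (N^n)^(- s), and mass at
    least 1 / 2 in the common ball, by [group_concentration]. *)
Lemma rho_mass t N : (0 < N)%N ->
  ((2^-1 * N%:R `^ (n%:R * (1 - s)))%:E <=
   \int[mu]_(x in [set x | (dot x x <= tail_radius roots k * (n * N).+1%:R)%R])
     (rho t N x)%:E)%E.
Proof.
move=> N0; set B := [set x | _].
have mB : measurable B by exact: measurable_dot_le.
have mu2 j : measurable_fun B (fun x => (Normc.normc (U t (cgauss (f j)) x) ^+ 2)%:E).
  apply: measurable_funTS; apply: measurableT_comp => //; apply: measurable_funX.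
  exact: cmeasurable_normc (L2_cmeasurable (LU t j)).
have M0 : (0 < N ^ n)%N by rewrite expn_gt0 N0.
have M0' : 0 < (N ^ n)%:R :> R by rewrite ltr0n.
under eq_integral do rewrite /rho -sumEFin.
rewrite ge0_integral_sum//; last 2 first.
- move=> j; under eq_fun do rewrite EFinM.
  exact: measurable_funeM.
- by move=> j x _; rewrite lee_fin mulr_ge0 ?powR_ge0 ?sqr_ge0.
apply: (@le_trans _ _ (\sum_(j < N ^ n) ((N ^ n)%:R `^ (- s) * 2^-1)%:E)%E).
  rewrite sumEFin lee_fin big_const card_ord iter_addr addr0 -[leRHS]mulr_natr.
  rewrite -[leRHS]mulrA [leRHS]mulrCA ler_wpM2l ?invr_ge0//.
  rewrite -[X in _ <= _ * X]powRr1// -powRD; last by apply/implyP => _; rewrite gt_eqF.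
  by rewrite natrX -powR_mulrn// -powRrM [- s + 1]addrC.
apply: lee_sum => j _.
under eq_integral do rewrite EFinM.
rewrite ge0_integralZl//=; last 2 first.
- by move=> x _; rewrite lee_fin sqr_ge0.
- by rewrite lee_fin powR_ge0.
rewrite EFinM; apply: lee_pmul.
- by rewrite lee_fin powR_ge0.
- by rewrite lee_fin.
- rewrite lee_fin /a !powRN lef_pV2 ?posrE ?powR_gt0//.
  by rewrite ge0_ler_powR ?nnegrE ?ler_nat ?ltW.
exact: (group_concentration roots_sys k_ge0 U_group t (f_deg (ltn_ord j)) (f_norm j)).
Qed.

(** The exponent theta is that of m0^p V^(1 - p) in N. As theta > 0, the lower bounds obtained for
    the successive N are unbounded. *)
Lemma Lnorm_density t :
  0 < n%:R * (1 - s) * p - D / 2 * (p - 1) ->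
  ('N[mu]_p%:E[density (fun j => (a j)%:C%C) (fun j => U t (cgauss (f j)))] = +oo)%E.
Proof.
set theta := _ - _ => theta0.
have p0 : 0 < p by rewrite (lt_le_trans ltr01).
have [C1 C10 BV] := ball_growth.
pose c := 4^-1 * (4 * C1)^-1 `^ (p - 1).
have c0 : 0 < c by rewrite mulr_gt0// powR_gt0// invr_gt0 mulr_gt0.
rewrite unlock; apply: eqy_poweR; first by rewrite invr_gt0.
set J := (\int[mu]_x _)%E.
have J0 : (0 <= J)%E by apply: integral_ge0 => x _; exact: poweR_ge0.
have lower N : (0 < N)%N -> ((c * N%:R `^ theta)%:E <= J)%E.
  move=> N0; have N0' : 0 < N%:R :> R by rewrite ltr0n.
  pose m0 := 2^-1 * N%:R `^ (n%:R * (1 - s)) : R.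
  have m00 : 0 < m0 by rewrite mulr_gt0// powR_gt0.
  have V0 : 0 < C1 * N%:R `^ (D / 2) by rewrite mulr_gt0// powR_gt0.
  have := concentrated_Lp_bound p_ge1 m00 V0 (measurable_dot_le _)
    (measurable_rho t N) (rho_ge0 t N) (BV _ N0) (rho_mass t N0).
  have -> : m0 / 2 * (m0 / (2 * (C1 * N%:R `^ (D / 2)))) `^ (p - 1) =
      c * N%:R `^ theta.
    have -> : m0 / (2 * (C1 * N%:R `^ (D / 2))) =
        (4 * C1)^-1 * N%:R `^ (n%:R * (1 - s) - D / 2).
      rewrite powRD; last by apply/implyP => _; rewrite gt_eqF.
      rewrite powRN /m0; field.
      by rewrite !gt_eqF// powR_gt0.
    rewrite powRM ?powR_ge0//; last by rewrite invr_ge0 mulr_ge0// ltW.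
    rewrite -powRrM /m0 /c.
    have -> : theta = n%:R * (1 - s) + (n%:R * (1 - s) - D / 2) * (p - 1).
      by rewrite /theta; ring.
    rewrite [N%:R `^ (_ + _)]powRD; last by apply/implyP => _; rewrite gt_eqF.
    by field.
  move=> /le_trans; apply; apply: le_integral_nonneg => x.
    by rewrite lee_fin powR_ge0.
  rewrite -poweR_EFin; apply: gt0_ler_poweR; first exact: ltW.
  - by rewrite in_itv/= leey andbT lee_fin rho_ge0.
  - by rewrite in_itv/= leey andbT abse_ge0.
  by apply: le_trans (density_ge t N x) _; rewrite lee_abs.
apply/eqP; rewrite -leye_eq leNgt; apply/negP => Joo.
have Jfin : J \is a fin_num by rewrite ge0_fin_numE.
(* N is taken at least Z^(1 / theta), so that c N^theta exceeds the supposedly finite integral J. *)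
pose Z := fine J / c + 1.
have Z0 : 0 < Z by rewrite ltr_wpDl// divr_ge0 ?fine_ge0// ltW.
pose N := (Num.bound (Z `^ theta^-1)).+1.
have NZ : Z `^ theta^-1 <= N%:R.
  apply: ltW; apply: lt_le_trans (archi_boundP _) _; first exact: powR_ge0.
  by rewrite ler_nat.
have := lower N isT; rewrite -(fineK Jfin) lee_fin; apply/negP; rewrite -ltNge.
rewrite mulrC -ltr_pdivrMr//; apply: (@lt_le_trans _ _ Z); first by rewrite ltrDl.
apply: (@le_trans _ _ ((Z `^ theta^-1) `^ theta)).
  by rewrite -powRrM mulVf ?gt_eqF// powRr1// ltW.
by apply: ge0_ler_powR; rewrite ?nnegrE ?powR_ge0// ltW.
Qed.

End blow_up.

Theorem theorem1p5 (R : realType) (n : nat) (n_ge1 : (1 <= n)%N)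
  (roots : {fset 'rV[R]_n}) (roots_sys : root_system roots)
  (b : 'rV[R]_n) (b_regular : regular roots b)
  (k : 'rV[R]_n -> R) (k_mult : multiplicity roots k)
  (k_ge0 : forall a, a \in roots -> 0 <= k a)
  (U : R -> ('rV[R]_n -> R[i]) -> ('rV[R]_n -> R[i]))
  (U_group : dunkl_hermite_group roots k b U)
  (p : R) (q r : \bar R) (p_ge1 : 1 <= p) (q_ge1 : (1 <= q)%E)
  (p_lt : 1 < p -> 2 * dunkl_gamma roots k < n%:R * (p + 1) / (p - 1))
  (r_gt : ((2 * p * n%:R /
     ((p + 1) * n%:R - (p - 1) * (2 * dunkl_gamma roots k)))%:E < r)%E) :
  exists (f : nat -> 'rV[R]_n -> R[i]) (l : nat -> R[i]),
    [/\ orthonormal_system roots k f,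
        (lr_norm r l < +oo)%E &
        mixed_norm (dunkl_nmeasure roots k)
          (measurable_itv `](- (pi / 2))%R, (pi / 2)%R[) q p%:E
          (fun t => density l (fun j => U t (f j))) = +oo%E].
Proof.
have n0 : 0 < n%:R :> R by rewrite ltr0n.
have p0 : 0 < p by rewrite (lt_le_trans ltr01).
set gam := dunkl_gamma roots k in p_lt r_gt.
set Delta := (p + 1) * n%:R - (p - 1) * (2 * gam) in r_gt.
(* For p = 1 this is 2 n > 0; for p > 1 it is [p_lt] with the denominator cleared. *)
have Delta0 : 0 < Delta.
  rewrite subr_gt0; move: p_ge1; rewrite le_eqVlt => /predU1P[<-|p1].
    by rewrite subrr mul0r mulr_gt0.
  have p10 : 0 < p - 1 by rewrite subr_gt0.
  by have := p_lt p1; rewrite ltr_pdivlMr// mulrC [n%:R * _]mulrC.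
set r0 := 2 * p * n%:R / Delta in r_gt.
have r00 : 0 < r0 by rewrite divr_gt0// !mulr_gt0.
have r_gt0 : (0 < r)%E by apply: lt_trans r_gt; rewrite lte_fin.
(* The midpoint of 1 / r and 1 / r0 for finite r, and half of 1 / r0 for r = +oo, where the last
   condition is vacuous. *)
have [s [s0 sr0 sr]] : exists s : R, [/\ 0 < s, s < r0^-1 &
    forall r', r = r'%:E -> 1 < s * r'].
  case: r r_gt r_gt0 => [r'| |]// r_gt r_gt0.
    rewrite lte_fin in r_gt; rewrite lte_fin in r_gt0.
    have rr : r'^-1 < r0^-1 by rewrite ltf_pV2.
    have ri : 0 < r'^-1 by rewrite invr_gt0.
    exists ((r'^-1 + r0^-1) / 2); split; [lra|lra|].
    move=> _ [<-]; rewrite -ltr_pdivrMr// div1r; lra.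
  exists (r0^-1 / 2); split=> //; first by rewrite divr_gt0// invr_gt0.
  by rewrite ltr_pdivrMr// ltr_pMr ?invr_gt0// ltr1n.
have [f [f_deg f_ort]] := orthonormal_polynomials n_ge1 roots_sys k_ge0.
have Lf j : in_L2 roots k (cgauss (f j)).
  exact: (cgauss_L2 k_ge0 (good_degree_pol n_ge1 (@f_deg j))).
have f_norm j : norm2 roots k (cgauss (f j)) = 1.
  have := inner_norm2 (Lf j); rewrite f_ort eqxx => /esym/eqP.
  by rewrite sqrp_eq1 ?norm2_ge0// => /eqP.
exists (fun j => cgauss (f j)), (fun j => (j.+1%:R `^ (- s))%:C%C); split.
- by split.
- exact: lr_norm_powR.
have theta0 : 0 < n%:R * (1 - s) * p - dunkl_dim roots k / 2 * (p - 1).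
  have -> : n%:R * (1 - s) * p - dunkl_dim roots k / 2 * (p - 1) =
      (r0^-1 - s) * (n%:R * p).
    rewrite /r0 /dunkl_dim -/gam invf_div mulrBl.
    have -> : Delta / (2 * p * n%:R) * (n%:R * p) = Delta / 2.
      by field; rewrite !gt_eqF.
    by rewrite /Delta; field.
  by rewrite mulr_gt0 ?subr_gt0// mulr_gt0.
rewrite /mixed_norm.
(* The inner norm is +oo at every t, so the outer one is that of a constant on an interval of length
   pi, for finite and infinite q alike. *)
under eq_Lnorm => t.
  rewrite (Lnorm_density n_ge1 roots_sys k_ge0 U_group f_deg f_norm s0 p_ge1 t theta0).
  over.
apply: Lnorm_cst_pinfty => //.
rewrite /= /mrestr setTI lebesgue_measure_itv/= lte_fin.
have pi0 := pi_gt0 R.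
by rewrite ifT; [rewrite -EFinD lte_fin; lra|lra].
Qed.
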